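(* Let $(A,u)$, $u=(u_{ij})_{1\le i,j\le n}$, be a homogeneous compact matrix quantum group such that $u_{ij}^*=u_{ij}$ and $u_{ij}^2$ is a central projection in $A$ for all $i,j\in\{1,\dots,n\}$. Then there is a quotient $\mathbb{Z}_2^{*n}\twoheadrightarrow\Gamma$ whose kernel is invariant under the natural action of $S_n$ such that $A$ is a version of $C^*(\Gamma)\bowtie C(S_n)$. In particular, we have $A\cong C^*(\Gamma)\bowtie C(S_n)$ if $A$ is in its maximal version.
   Context: A compact matrix quantum group (CMQG) is a pair $(A,u)$ of a unital $C^*$-algebra $A$ and a unitary $u=(u_{ij})\in M_n(A)$ (the fundamental corepresentation) such that the $u_{ij}$ generate $A$ as a $C^*$-algebra, there is a $*$-homomorphism $\Delta:A\to A\otimes A$ (comultiplication) with $\Delta(u_{ij})=\sum_k u_{ik}\otimes u_{kj}$ for all $i,j$, and the transpose $u^t$ is invertible. A morphism between CMQGs $(A,u_A)$ and $(B,u_B)$ is a morphism $\phi:A\to B$ of the underlying $C^*$-algebras such that the matrix obtained by applying $\phi$ to the entries of $u_A$ is conjugate to $u_B$ by some element of $GL(n,\mathbb{C})$. Two CMQGs are isomorphic (written $\cong$) if they are isomorphic as $C^*$-algebras via a morphism preserving the fundamental corepresentation. $\mathrm{Pol}(A)$ is the $*$-subalgebra of $A$ generated by the $u_{ij}$. The maximal version of $(A,u)$ is the universal enveloping $C^*$-algebra of $\mathrm{Pol}(A)$, which is again a CMQG; $A$ is in its maximal version if it is isomorphic to its maximal version. If $B$ is a CMQG in its maximal version, then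 any CMQG whose maximal version is isomorphic to $B$ is called a version of $B$. $C(S_n)$, the algebra of functions on the permutation group $S_n$, is a CMQG with fundamental corepresentation $p=(p_{ij})$, where $p_{ij}(\sigma)=1$ if $\sigma(j)=i$ and $0$ otherwise; equivalently it is the universal $C^*$-algebra generated by commuting projections $p_{ij}$ such that $p=(p_{ij})$ is unitary. A CMQG $(A,u)$ is called homogeneous if there is a morphism of CMQGs $A\to C(S_n)$. $\mathbb{Z}_2^{*n}$ is the free product of $n$ copies of $\mathbb{Z}/2\mathbb{Z}$ with canonical generators $a_1,\dots,a_n$; $S_n$ acts on it naturally by permuting $a_1,\dots,a_n$. If $\Gamma$ is a group generated by $g_1,\dots,g_n$ on which $S_n$ acts by permuting $g_1,\dots,g_n$, then $C^*(\Gamma)\bowtie C(S_n)$ (the semi-direct product quantum group) denotes the CMQG with $C^*$-algebra $C^*(\Gamma)\otimes C(S_n)$, where $C^*(\Gamma)$ is the maximal group $C^*$-algebra with canonical unitaries $u_g$, $g\in\Gamma$, and with fundamental corepresentation $(u_{g_i}p_{ij})_{i,j}$. For a quotient $\Gamma$ of $\mathbb{Z}_2^{*n}$ with $S_n$-invariant kernel, $g_i$ is the image of $a_i$.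
   Formalization: ''Homogeneous'' is taken to mean that there is a *-homomorphism A→C(S_n) with u_ij ↦ p_ij exactly, not merely up to GL(n,C)-conjugation; with conjugation the claim fails, e.g. for C(G), G={diag(1,±1)}, n=2. *)

(* Defs.v *)
From HB Require Import structures.
From mathcomp Require Import all_boot all_order all_algebra perm.
From mathcomp Require Import all_classical all_reals.
From mathcomp Require Import complex ring lra.

Set Implicit Arguments.
Unset Strict Implicit.
Unset Printing Implicit Defensive.

Import Order.TTheory GRing.Theory Num.Theory.
Local Open Scope ring_scope.

(* Nonzero unital C*-algebras; the norm takes values in [R], not [R[i]]. *)
HB.mixin Record isCStar (R : realType) A of GRing.Algebra R[i] A := {
  star : A -> A;
  starK : involutive star;
  starD : {morph star : x y / x + y};
  starZ : forall (c : R[i]) x, star (c *: x) = (c^*)%C *: star x;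
  starM : forall x y, star (x * y) = star y * star x;
  cnorm : A -> R;
  cnorm_eq0 : forall x, cnorm x = 0 -> x = 0;
  ler_cnormD : forall x y, cnorm (x + y) <= cnorm x + cnorm y;
  cnormZ : forall (c : R[i]) x, cnorm (c *: x) = Normc.normc c * cnorm x;
  ler_cnormM : forall x y, cnorm (x * y) <= cnorm x * cnorm y;
  cnorm_star2 : forall x, cnorm (star x * x) = cnorm x ^+ 2;
  cnorm_complete : forall u : nat -> A,
    (forall e : R, 0 < e -> exists N, forall m n, (N <= m)%N -> (N <= n)%N ->
       cnorm (u m - u n) < e) ->
    exists l, forall e : R, 0 < e -> exists N, forall n, (N <= n)%N ->
       cnorm (u n - l) < e
}.

#[short(type="cstarAlgType")]
HB.structure Definition CStarAlgebra (R : realType) :=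
  {A of GRing.Algebra R[i] A & isCStar R A}.

Section CStarTheory.
Variables (R : realType) (A : cstarAlgType R).
Implicit Types (x y : A) (u : nat -> A).

Definition cconv u x := forall e : R, 0 < e ->
  exists N, forall n, (N <= n)%N -> cnorm (u n - x) < e.

Lemma cnorm0 : cnorm (0 : A) = 0.
Proof. by rewrite -(scale0r 0) cnormZ Normc.normc0 mul0r. Qed.

Lemma cnormN x : cnorm (- x) = cnorm x.
Proof.
rewrite -scaleN1r cnormZ /Normc.normc /= oppr0 sqrrN expr1n expr0n addr0.
by rewrite sqrtr1 mul1r.
Qed.

Lemma cnorm_ge0 x : 0 <= cnorm x.
Proof.
have := ler_cnormD x (- x); rewrite cnormN subrr cnorm0 -mulr2n.
by rewrite pmulrn_lge0.
Qed.

Lemma cnorm_distC x y : cnorm (x - y) = cnorm (y - x).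
Proof. by rewrite -cnormN opprB. Qed.

Lemma ler_cnormB x y z : cnorm (x - z) <= cnorm (x - y) + cnorm (y - z).
Proof. by rewrite -{1}[x](subrK y) -addrA ler_cnormD. Qed.

Lemma star0 : star (0 : A) = 0.
Proof. by rewrite -(scale0r 0) starZ conjc0 !scale0r. Qed.

Lemma starN x : star (- x) = - star x.
Proof. by apply/eqP; rewrite -addr_eq0 -starD addNr star0. Qed.

Lemma starB x y : star (x - y) = star x - star y.
Proof. by rewrite starD starN. Qed.

Lemma star1 : star (1 : A) = 1.
Proof. by rewrite -[LHS]mulr1 -{2}(starK 1) -starM mulr1 starK. Qed.

Lemma cnorm_star x : cnorm (star x) = cnorm x.
Proof.
suff le y : cnorm y <= cnorm (star y).
  by apply/eqP; rewrite eq_le le andbT -{2}(starK x) le.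
have [->|y0] := eqVneq (cnorm y) 0; first exact: cnorm_ge0.
have y_gt0 : 0 < cnorm y by rewrite lt_def y0 cnorm_ge0.
by rewrite -(ler_pM2r y_gt0) -expr2 -cnorm_star2 ler_cnormM.
Qed.

Lemma cnorm1 : cnorm (1 : A) = 1.
Proof.
have := cnorm_star2 (1 : A); rewrite star1 mulr1 expr2 => h.
have n0 : cnorm (1 : A) != 0.
  by apply/eqP => /cnorm_eq0/eqP; rewrite oner_eq0.
by apply: (mulfI n0); rewrite -h mulr1.
Qed.

Lemma cnorm_unitary x : star x * x = 1 -> cnorm x = 1.
Proof.
move=> h; have /eqP := cnorm_star2 x; rewrite h cnorm1 eq_sym sqrf_eq1.
case/orP => /eqP // x1; have := cnorm_ge0 x.
by rewrite x1 leNgt ltrN10.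
Qed.

Lemma cconv_unique u x y : cconv u x -> cconv u y -> x = y.
Proof.
move=> ux uy; apply/eqP; rewrite -subr_eq0; apply/eqP/cnorm_eq0/eqP.
rewrite eq_le cnorm_ge0 andbT; apply/ler_addgt0Pr => e e0; rewrite add0r.
have e2 : 0 < e / 2 by rewrite divr_gt0.
have [N1 h1] := ux _ e2; have [N2 h2] := uy _ e2.
apply: (le_trans (ler_cnormB _ (u (maxn N1 N2)) _)).
by rewrite (splitr e) cnorm_distC lerD// ltW// (h1,h2)// (leq_maxl,leq_maxr).
Qed.

End CStarTheory.

Definition star_hom (R : realType) (A B : cstarAlgType R) (f : A -> B) :=
  [/\ {morph f : x y / x + y}, forall (c : R[i]) x, f (c *: x) = c *: f x,
      {morph f : x y / x * y}, f 1 = 1 & forall x, f (star x) = star (f x)].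

Section Limits.
Variables (R : realType) (A : cstarAlgType R).
Implicit Types (x y : A) (u v : nat -> A).

Lemma cconv_cst x : cconv (fun=> x) x.
Proof. by move=> e e0; exists 0%N => n _; rewrite subrr cnorm0. Qed.

Lemma cconv_eq u v x : u =1 v -> cconv u x -> cconv v x.
Proof.
move=> uv ux e /ux[N h]; exists N => n /h; by rewrite uv.
Qed.

Lemma cconvS u x : cconv u x -> cconv (fun n => u n.+1) x.
Proof. by move=> ux e /ux[N h]; exists N => n Nn; apply/h/leqW. Qed.

Lemma cconv_star u x : cconv u x -> cconv (fun n => star (u n)) (star x).
Proof.
by move=> ux e /ux[N h]; exists N => n /h; rewrite -starB cnorm_star.
Qed.

Lemma cconvD u v x y : cconv u x -> cconv v y -> cconv (fun n => u n + v n) (x + y).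
Proof.
move=> ux vy e e0; have e2 : 0 < e / 2 by rewrite divr_gt0.
have [N1 h1] := ux _ e2; have [N2 h2] := vy _ e2.
exists (maxn N1 N2) => n; rewrite geq_max => /andP[/h1 {}h1 /h2 {}h2].
rewrite opprD addrACA (splitr e); apply: le_lt_trans (ler_cnormD _ _) _.
exact: ltrD.
Qed.

Lemma cconvM u v x y : cconv u x -> cconv v y -> cconv (fun n => u n * v n) (x * y).
Proof.
move=> ux vy e e0; have X0 := cnorm_ge0 x; have Y0 := cnorm_ge0 y.
pose d := Num.min 1 (e / (cnorm x + cnorm y + 2)).
have D0 : 0 < cnorm x + cnorm y + 2 by lra.
have d0 : 0 < d by rewrite lt_min ltr01 divr_gt0.
have d1 : d <= 1 by rewrite ge_min lexx.
have de : d * (cnorm x + cnorm y + 2) <= e.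
  by rewrite -ler_pdivlMr// ge_min lexx orbT.
have [N1 h1] := ux _ d0; have [N2 h2] := vy _ d0.
exists (maxn N1 N2) => n; rewrite geq_max => /andP[/h1 {}h1 /h2 {}h2].
have -> : u n * v n - x * y = (u n - x) * v n + x * (v n - y).
  by rewrite mulrBl mulrBr addrA subrK.
have vn : cnorm (v n) <= 1 + cnorm y.
  rewrite -[v n](subrK y); apply: le_trans (ler_cnormD _ _) _.
  by rewrite lerD2r; apply: ltW; apply: lt_le_trans d1.
apply: le_lt_trans (ler_cnormD _ _) _.
apply: (@le_lt_trans _ _ (d * (1 + cnorm y) + cnorm x * d)); last by nra.
apply: lerD; apply: le_trans (ler_cnormM _ _) _.
- by apply: ler_pM => //; rewrite ?cnorm_ge0// ltW.
- by apply: ler_wpM2l => //; apply: ltW.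
Qed.

Lemma cconvZ (c : R[i]) u x : cconv u x -> cconv (fun n => c *: u n) (c *: x).
Proof.
move=> ux; have := cconvM (cconv_cst (c *: (1 : A))) ux.
rewrite -scalerAl mul1r; apply: cconv_eq => n.
by rewrite -scalerAl mul1r.
Qed.

End Limits.

Lemma bernoulli (R : realType) (t : R) n : 0 <= t -> 1 + n%:R * t <= (1 + t) ^+ n.
Proof.
move=> t0; elim: n => [|n IH]; first by rewrite mul0r addr0 expr0.
rewrite exprS; have : 0 <= n%:R * t :> R by rewrite mulr_ge0.
move: IH; rewrite -natr1; set a := n%:R * t; set b := _ ^+ n => IH a0.
have -> : 1 + (n%:R + 1) * t = 1 + a + t by rewrite /a; ring.
nra.
Qed.

Lemma exists_expr_lt (R : realType) (s e : R) : 0 <= s < 1 -> 0 < e ->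
  exists N, s ^+ N < e.
Proof.
move=> /andP[s0 s1] e0; have [->|sn0] := eqVneq s 0.
  by exists 1%N; rewrite expr1.
have {s0 sn0}s0 : 0 < s by rewrite lt_def sn0.
pose t := s^-1 - 1; have t0 : 0 < t by rewrite subr_gt0 invf_gt1.
have : 0 <= e^-1 / t by rewrite divr_ge0 ?invr_ge0 ?ltW.
move/archi_boundP.
set N := Num.bound _ => h; exists N.
have -> : s = (1 + t)^-1 by rewrite /t addrC subrK invrK.
have t1 : 0 < 1 + t by lra.
rewrite exprVn -[e]invrK ltf_pV2 ?posrE ?invr_gt0 ?exprn_gt0//.
apply: lt_le_trans (bernoulli _ (ltW t0)).
by move: h; rewrite ltr_pdivrMr//; lra.
Qed.

Section SqrtOneMinusSquare.
Variables (R : realType) (A : cstarAlgType R) (h : A).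
Hypotheses (h_sa : star h = h) (h_lt1 : cnorm h < 1).

Let b := h * h.
Let s := cnorm h ^+ 2.
Let y n := iter n (fun z : A => (2^-1 : R[i]) *: (b + z * z)) 0.

Let yS n : y n.+1 = (2^-1 : R[i]) *: (b + y n * y n).
Proof. by []. Qed.

Let s01 : 0 <= s < 1.
Proof. by rewrite /s exprn_ge0 ?cnorm_ge0//= expr_lt1// ?cnorm_ge0. Qed.

Let normc_half : Normc.normc (2^-1 : R[i]) = 2^-1.
Proof.
rewrite Normc.normcV; congr (_^-1).
have -> : (2 : R[i]) = 2%:C%C by rewrite rmorphMn rmorph1.
by rewrite /Normc.normc /= expr0n addr0 sqrtr_sqr ger0_norm.
Qed.

Let cnorm_half (x : A) : cnorm ((2^-1 : R[i]) *: x) = cnorm x / 2.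
Proof. by rewrite cnormZ normc_half mulrC. Qed.

Let cnorm_b : cnorm b = s.
Proof. by rewrite /b -{1}h_sa cnorm_star2. Qed.

Let y_bound n : cnorm (y n) <= s.
Proof.
have /andP[s0 s1] := s01; elim: n => [|n IH]; first by rewrite cnorm0.
rewrite /= cnorm_half ler_pdivrMr// -/(y n); apply: le_trans (ler_cnormD _ _) _.
have := ler_cnormM (y n) (y n); have := cnorm_ge0 (y n); rewrite cnorm_b; nra.
Qed.

Let y_comm n z : GRing.comm h z -> GRing.comm (y n) z.
Proof.
move=> hz; elim: n => [|n IH]; first exact/commr_sym/commr0.
rewrite yS /GRing.comm -scalerAl -scalerAr; congr (_ *: _).
have bz : GRing.comm z b by apply: commrM; apply: commr_sym.
have yz : GRing.comm z (y n * y n) by apply: commrM; apply: commr_sym.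
by apply/esym; apply: commrD.
Qed.

Let y_sa n : star (y n) = y n.
Proof.
elim: n => [|n IH]; first exact: star0.
rewrite yS starZ starD /b !starM h_sa IH; congr (_ *: _).
have -> : (2^-1 : R[i]) = (2^-1)%:C%C by rewrite fmorphV rmorphMn rmorph1.
by rewrite conjc_real.
Qed.

Let y_step n : cnorm (y n.+1 - y n) <= s ^+ n.
Proof.
have /andP[s0 s1] := s01.
elim: n => [|n IH]; first by rewrite subr0 expr0 (le_trans (y_bound 1))// ltW.
have -> : y n.+2 - y n.+1 = (2^-1 : R[i]) *: ((y n.+1 - y n) * (y n.+1 + y n)).
  rewrite [y n.+2]yS [X in _ - X = _]yS.
  rewrite -scalerBr; congr (_ *: _).
  have /esym c : GRing.comm (y n) (y n.+1) by apply/y_comm/commr_sym/y_comm.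
  rewrite mulrBl !mulrDr c opprD addrACA subrr add0r.
  by rewrite opprD addrA addrK.
rewrite cnorm_half ler_pdivrMr//; apply: le_trans (ler_cnormM _ _) _.
have := ler_cnormD (y n.+1) (y n); have := y_bound n.+1; have := y_bound n.
rewrite exprS; have := cnorm_ge0 (y n.+1 - y n).
have := cnorm_ge0 (y n.+1 + y n); move: IH; nra.
Qed.

Let y_dist n k : cnorm (y (n + k)%N - y n) * (1 - s) <= s ^+ n.
Proof.
have /andP[s0 s1] := s01.
suff: cnorm (y (n + k)%N - y n) * (1 - s) <= s ^+ n - s ^+ (n + k).
  by move/le_trans; apply; rewrite lerBlDr lerDl exprn_ge0.
elim: k => [|k IH]; first by rewrite addn0 !subrr cnorm0 mul0r.
have := ler_cnormB (y (n + k.+1)%N) (y (n + k)%N) (y n).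
have := y_step (n + k); rewrite addnS exprS; move: IH.
have := cnorm_ge0 (y (n + k).+1 - y n); nra.
Qed.

Lemma sqrt_one_minus_square :
  exists k : A, [/\ star k = k, h * k = k * h & h * h + k * k = 1].
Proof.
have /andP[s0 s1] := s01; have s1' : 0 < 1 - s by rewrite subr_gt0.
have [e e0|l yl] := @cnorm_complete R A y.
  have e2 : 0 < e / 2 * (1 - s) by rewrite mulr_gt0 ?divr_gt0.
  have [N hN] := exists_expr_lt s01 e2.
  exists N => m n.
  suff hh p : (N <= p)%N -> cnorm (y p - y N) < e / 2.
    move=> /hh hm /hh; rewrite cnorm_distC => hn; rewrite (splitr e).
    by apply: le_lt_trans (ler_cnormB _ (y N) _) _; apply: ltrD.
  move=> /subnKC <-; rewrite -(ltr_pM2r s1').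
  exact: le_lt_trans (y_dist _ _) hN.
have lsa : star l = l.
  by apply: (cconv_unique (cconv_star yl)); apply: cconv_eq yl => n; rewrite y_sa.
have lh : h * l = l * h.
  apply: (cconv_unique (cconvM (cconv_cst h) yl)).
  apply: cconv_eq (cconvM yl (cconv_cst h)) => n.
  by apply: y_comm.
have le : l = (2^-1 : R[i]) *: (b + l * l).
  apply: (cconv_unique (cconvS yl)); apply: cconv_eq.
    by move=> n; rewrite yS.
  by apply: cconvZ; apply: cconvD; [exact: cconv_cst|exact: cconvM].
exists (1 - l); split.
- by rewrite starB star1 lsa.
- by rewrite mulrBr mulrBl mulr1 mul1r lh.
have : b + l * l = l + l.
  rewrite -mulr2n -[in RHS]scaler_nat [in RHS]le scalerA divff ?scale1r//.
  by rewrite pnatr_eq0.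
move/(canRL (addrK _)); rewrite mulrBl mul1r mulrBr mulr1 -/b => ->.
have -> : 1 - l - (l - l * l) = 1 - (l + l - l * l).
  by rewrite -[LHS]addrA -opprD addrA.
by rewrite addrC subrK.
Qed.

End SqrtOneMinusSquare.

Lemma star_hom_contractive (R : realType) (A B : cstarAlgType R) (f : A -> B) :
  star_hom f -> forall x, cnorm (f x) <= cnorm x.
Proof.
move=> [fD fZ fM f1 fS].
have lt1 h : star h = h -> cnorm h < 1 -> cnorm (f h) <= 1.
  move=> hS h1; have [k [kS hk hk1]] := sqrt_one_minus_square hS h1.
  pose U := h + ('i%C : R[i]) *: k.
  have SU : star U = h - ('i%C : R[i]) *: k.
    rewrite /U starD starZ hS kS -scaleNr; congr (_ + _ *: _).
    by apply/eqP; rewrite eq_complex /= oppr0 !eqxx.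
  have UU : star U * U = 1.
    rewrite SU /U mulrBl !mulrDr -!scalerAl -!scalerAr scalerA.
    rewrite -[('i * 'i)%C]expr2 sqr_i.
    by rewrite hk scaleN1r opprD opprK addrA addrK.
  have fUU : star (f U) * f U = 1 by rewrite -fS -fM UU.
  have nU := cnorm_unitary fUU.
  have := ler_cnormD (f U) (f (star U)); rewrite -fD fS cnorm_star nU SU.
  rewrite addrACA subrr addr0 fD -mulr2n -scaler_nat cnormZ.
  have -> : (2 : R[i]) = 2%:C%C by rewrite rmorphMn rmorph1.
  rewrite /Normc.normc /= expr0n addr0 sqrtr_sqr ger0_norm//; lra.
have sa h : star h = h -> cnorm (f h) <= cnorm h.
  move=> hS; apply/ler_addgt0Pr => e e0; set r := cnorm h + e.
  have r0 : 0 < r by rewrite ltr_wpDl ?cnorm_ge0.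
  have nr t : 0 < t -> Normc.normc (t%:C%C : R[i]) = t :> R.
    by move=> t0; rewrite /Normc.normc /= expr0n addr0 sqrtr_sqr gtr0_norm.
  have := @lt1 ((r^-1)%:C%C *: h); rewrite fZ !cnormZ nr ?invr_gt0//.
  rewrite starZ conjc_real hS => /(_ erefl).
  by rewrite ![r^-1 * _]mulrC ltr_pdivrMr// ler_pdivrMr// !mul1r ltrDl => /(_ e0).
move=> x; rewrite -(ler_pXn2r (n := 2))// ?nnegrE ?cnorm_ge0//.
by rewrite -!cnorm_star2 -fS -fM sa// starM starK.
Qed.
Lemma real_complete (R : realType) (u : nat -> R) :
  (forall e, 0 < e -> exists N, forall m n, (N <= m)%N -> (N <= n)%N ->
     `|u m - u n| < e) ->
  exists l, forall e, 0 < e -> exists N, forall n, (N <= n)%N -> `|u n - l| < e.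
Proof.
move=> uC; pose S := [set x | exists N, forall n, (N <= n)%N -> x <= u n]%classic.
have near_S e : 0 < e -> exists N, [/\ forall n, (N <= n)%N -> `|u n - u N| < e,
    S (u N - e) & ubound S (u N + e)].
  move=> e0; have [N hN] := uC e e0; exists N; split.
  - by move=> n Nn; apply: hN.
  - exists N => n Nn; have := hN n N Nn (leqnn _); rewrite ltr_norml; lra.
  - move=> x [M hM]; have := hM (maxn M N) (leq_maxl _ _).
    have := hN (maxn M N) N (leq_maxr _ _) (leqnn _); rewrite ltr_norml; lra.
have hS : has_sup S.
  have [N [_ h1 h2]] := near_S 1 ltr01.
  by split; [exists (u N - 1) | exists (u N + 1)].
exists (sup S) => e e0; have e3 : 0 < e / 3 by rewrite divr_gt0.
have [N [h1 h2 h3]] := near_S _ e3; exists N => n /h1.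
have := sup_upper_bound hS h2; have := ge_sup hS.1 h3.
rewrite !ltr_norml; lra.
Qed.

Section ComplexCStar.
Variable R : realType.
Local Notation C := (R[i]^o).

Let normc_ReIm (x : R[i]) : [/\ `|complex.Re x| <= Normc.normc x,
  `|complex.Im x| <= Normc.normc x &
  Normc.normc x <= `|complex.Re x| + `|complex.Im x|].
Proof.
case: x => a b /=; split.
- by rewrite -sqrtr_sqr ler_sqrt ?lerDl ?addr_ge0 ?sqr_ge0.
- by rewrite -sqrtr_sqr ler_sqrt ?lerDr ?addr_ge0 ?sqr_ge0.
- rewrite -[leRHS]ger0_norm ?addr_ge0// -[leRHS]sqrtr_sqr.
  rewrite ler_sqrt ?sqr_ge0// sqrrD !real_normK ?num_real//.
  by rewrite addrAC lerDl mulrn_wge0 ?mulr_ge0.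
Qed.

Let normc_complete (u : nat -> C) :
  (forall e : R, 0 < e -> exists N, forall m n, (N <= m)%N -> (N <= n)%N ->
     Normc.normc (u m - u n) < e) ->
  exists l, forall e : R, 0 < e -> exists N, forall n, (N <= n)%N ->
     Normc.normc (u n - l) < e.
Proof.
move=> uC.
have [e /uC[N hN]|a ha] := @real_complete R (fun n => complex.Re (u n)).
  exists N => m n Nm Nn; apply: le_lt_trans (hN m n Nm Nn).
  by have [+ _ _] := normc_ReIm (u m - u n); rewrite raddfB.
have [e /uC[N hN]|b hb] := @real_complete R (fun n => complex.Im (u n)).
  exists N => m n Nm Nn; apply: le_lt_trans (hN m n Nm Nn).
  by have [_ + _] := normc_ReIm (u m - u n); rewrite raddfB.
exists (a +i* b)%C => e e0; have e2 : 0 < e / 2 by rewrite divr_gt0.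
have [N1 h1] := ha _ e2; have [N2 h2] := hb _ e2.
exists (maxn N1 N2) => n; rewrite geq_max => /andP[/h1 {}h1 /h2 {}h2].
have [_ _ /le_lt_trans] := normc_ReIm (u n - (a +i* b)%C); apply.
by rewrite !raddfB /= (splitr e) ltrD.
Qed.

Let normc_ge0 (x : R[i]) : 0 <= Normc.normc x.
Proof. by case: x => a b; exact: sqrtr_ge0. Qed.

Let normc_conj2 (x : C) : Normc.normc ((x^*)%C * x : R[i]) = Normc.normc x ^+ 2.
Proof. by rewrite Normc.normcM; case: x => a b /=; rewrite sqrrN expr2. Qed.

Let conjc_anti (x y : C) : ((x * y)^*)%C = (y^* * x^*)%C :> C.
Proof. by rewrite rmorphM mulrC. Qed.

Let normc_mul (x y : C) :
  Normc.normc (x * y : R[i]) <= Normc.normc x * Normc.normc y.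
Proof. by rewrite Normc.normcM. Qed.

HB.instance Definition _ := @isCStar.Build R C (@conjc R)
  (@conjcK R) (rmorphD (@conjc R)) (rmorphM (@conjc R)) conjc_anti
  (@Normc.normc R) (@Normc.eq0_normc R) (@le_normcD R)
  (@Normc.normcM R) normc_mul normc_conj2 normc_complete.

End ComplexCStar.
(* C(S_n, A) with the supremum norm. As S_n is finite, this is the tensor product
   of A with C(S_n): the algebraic tensor product, with its only C*-norm. *)
Definition SnFun (n : nat) (A : Type) : Type := {ffun 'S_n -> A}.

Section SnFunCStar.
Variables (R : realType) (n : nat) (A : cstarAlgType R).
Implicit Types (f g : SnFun n A).

HB.instance Definition _ := GRing.Lmodule.copy (SnFun n A) {ffun 'S_n -> A}.

Let sf1 : SnFun n A := [ffun => 1].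
Let sfmul f g : SnFun n A := [ffun s => f s * g s].

Let sfmulA : associative sfmul.
Proof. by move=> f g k; apply/ffunP => s; rewrite !ffunE mulrA. Qed.
Let sfmul1f : left_id sf1 sfmul.
Proof. by move=> f; apply/ffunP => s; rewrite !ffunE mul1r. Qed.
Let sfmulf1 : right_id sf1 sfmul.
Proof. by move=> f; apply/ffunP => s; rewrite !ffunE mulr1. Qed.
Let sfmulDl : left_distributive sfmul +%R.
Proof. by move=> f g k; apply/ffunP => s; rewrite !ffunE mulrDl. Qed.
Let sfmulDr : right_distributive sfmul +%R.
Proof. by move=> f g k; apply/ffunP => s; rewrite !ffunE mulrDr. Qed.
Let sf1_neq0 : sf1 != 0.
Proof. by apply/eqP => /ffunP/(_ 1%g)/eqP; rewrite !ffunE oner_eq0. Qed.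

HB.instance Definition _ := GRing.Zmodule_isNzRing.Build (SnFun n A)
  sfmulA sfmul1f sfmulf1 sfmulDl sfmulDr sf1_neq0.

Let sfscaleAl (c : R[i]) f g : c *: (f * g) = (c *: f) * g.
Proof. by apply/ffunP => s; rewrite !ffunE scalerAl. Qed.
HB.instance Definition _ := GRing.Lmodule_isLalgebra.Build R[i] (SnFun n A) sfscaleAl.

Let sfscaleAr (c : R[i]) f g : c *: (f * g) = f * (c *: g).
Proof. by apply/ffunP => s; rewrite !ffunE scalerAr. Qed.
HB.instance Definition _ := GRing.Lalgebra_isAlgebra.Build R[i] (SnFun n A) sfscaleAr.

Let sfstar f : SnFun n A := [ffun s => star (f s)].
Let sfnorm f : R := \big[Num.max/0]_s cnorm (f s).

Let sfnorm_ge0 f : 0 <= sfnorm f.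
Proof. exact: bigmax_ge_id. Qed.

Let sfnorm_ge f s : cnorm (f s) <= sfnorm f.
Proof. exact: le_bigmax. Qed.

Let sfnorm_le f r : 0 <= r -> (forall s, cnorm (f s) <= r) -> sfnorm f <= r.
Proof. by move=> r0 h; apply: bigmax_le. Qed.

Let sfnorm_lt f r : 0 < r -> (forall s, cnorm (f s) < r) -> sfnorm f < r.
Proof. by move=> r0 h; apply: bigmax_lt. Qed.

Let sfnorm_ex f : exists s, sfnorm f = cnorm (f s).
Proof.
have h := @bigmax_eq_arg _ R _ (0 : R) (1%g : 'S_n) xpredT
  (fun s => cnorm (f s)) isT (fun s _ => cnorm_ge0 (f s)).
by eexists; exact: h.
Qed.

Let sfstarK : involutive sfstar.
Proof. by move=> f; apply/ffunP => s; rewrite !ffunE starK. Qed.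
Let sfstarD : {morph sfstar : f g / f + g}.
Proof. by move=> f g; apply/ffunP => s; rewrite !ffunE starD. Qed.
Let sfstarZ (c : R[i]) f : sfstar (c *: f) = (c^*)%C *: sfstar f.
Proof. by apply/ffunP => s; rewrite !ffunE starZ. Qed.
Let sfstarM f g : sfstar (f * g) = sfstar g * sfstar f.
Proof. by apply/ffunP => s; rewrite !ffunE starM. Qed.
Let sfnorm_eq0 f : sfnorm f = 0 -> f = 0.
Proof.
move=> f0; apply/ffunP => s; rewrite ffunE; apply/cnorm_eq0/eqP.
by rewrite eq_le cnorm_ge0 andbT -f0 sfnorm_ge.
Qed.
Let sfnormD f g : sfnorm (f + g) <= sfnorm f + sfnorm g.
Proof.
apply: sfnorm_le => [|s]; first by rewrite addr_ge0.
by rewrite ffunE (le_trans (ler_cnormD _ _))// lerD.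
Qed.
Let sfnormZ (c : R[i]) f : sfnorm (c *: f) = Normc.normc c * sfnorm f.
Proof.
have c0 : 0 <= Normc.normc c by case: (c) => a b; exact: sqrtr_ge0.
apply/eqP; rewrite eq_le; apply/andP; split.
  apply: sfnorm_le => [|s]; first by rewrite mulr_ge0.
  by rewrite ffunE cnormZ ler_wpM2l.
have [s ->] := sfnorm_ex f.
by rewrite -cnormZ -(ffunE (fun s => c *: f s)) sfnorm_ge.
Qed.
Let sfnormM f g : sfnorm (f * g) <= sfnorm f * sfnorm g.
Proof.
apply: sfnorm_le => [|s]; first by rewrite mulr_ge0.
by rewrite ffunE (le_trans (ler_cnormM _ _))// ler_pM// cnorm_ge0.
Qed.
Let sfnorm_star2 f : sfnorm (sfstar f * f) = sfnorm f ^+ 2.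
Proof.
apply/eqP; rewrite eq_le; apply/andP; split.
  apply: sfnorm_le => [|s]; first by rewrite exprn_ge0.
  by rewrite !ffunE cnorm_star2 ler_pXn2r ?nnegrE ?cnorm_ge0.
have [s ->] := sfnorm_ex f; rewrite -cnorm_star2.
by apply: le_trans (sfnorm_ge _ s); rewrite !ffunE.
Qed.
Let sfnorm_complete (u : nat -> SnFun n A) :
  (forall e : R, 0 < e -> exists N, forall m n, (N <= m)%N -> (N <= n)%N ->
     sfnorm (u m - u n) < e) ->
  exists l, forall e : R, 0 < e -> exists N, forall n, (N <= n)%N ->
     sfnorm (u n - l) < e.
Proof.
move=> uC; have /choice[l hl] s : exists l, cconv (fun n => u n s) l.
  apply: cnorm_complete => e /uC[N hN]; exists N => m k Nm Nk.
  apply: le_lt_trans (hN m k Nm Nk).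
  by apply: le_trans (sfnorm_ge _ s); rewrite !ffunE.
exists [ffun s => l s] => e e0.
have /choice[N hN] s := hl s e e0.
exists (\max_s N s) => k Nk; apply: sfnorm_lt => // s.
by rewrite !ffunE hN// (leq_trans _ Nk)// leq_bigmax.
Qed.

HB.instance Definition _ := @isCStar.Build R (SnFun n A) sfstar sfstarK sfstarD
  sfstarZ sfstarM sfnorm sfnorm_eq0 sfnormD sfnormZ sfnormM sfnorm_star2
  sfnorm_complete.

End SnFunCStar.
Definition unitary_rep (R : realType) (G : groupType) (A : cstarAlgType R)
    (pi : G -> A) :=
  [/\ pi 1%g = 1, {morph pi : g h / (g * h)%g >-> g * h} &
      forall g, star (pi g) = pi g^-1%g].

Section MaximalGroupCStar.
Local Open Scope quotient_scope.
Variables (R : realType) (G : groupType).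

Record urep := URep {
  urep_alg : cstarAlgType R;
  urep_map : G -> urep_alg;
  urepP : unitary_rep urep_map
}.

(* The maximal group C*-algebra: formal *-algebraic expressions in the elements
   of [G], completed with formal limits of sequences that are Cauchy uniformly
   over all unitary representations, modulo having the same value in all of
   them. Its norm is the supremum over all unitary representations. *)
Inductive gexpr :=
  | GGen of G
  | GAdd of gexpr & gexpr
  | GMul of gexpr & gexpr
  | GScale of R[i] & gexpr
  | GStar of gexpr
  | GLim of (nat -> gexpr).

Definition ucauchy (u : nat -> forall i : urep, urep_alg i) :=
  forall e : R, 0 < e -> exists N, forall m n, (N <= m)%N -> (N <= n)%N ->
    forall i, cnorm (u m i - u n i) < e.

Fixpoint geval (x : gexpr) (i : urep) : urep_alg i :=
  match x with
  | GGen g => urep_map i g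
  | GAdd x y => geval x i + geval y i
  | GMul x y => geval x i * geval y i
  | GScale c x => c *: geval x i
  | GStar x => star (geval x i)
  | GLim f => if `[< ucauchy (fun n => geval (f n)) >]
              then xget 0 [set l | cconv (fun n => geval (f n) i) l]%classic
              else 0
  end.

Lemma gevalLim (f : nat -> gexpr) i : ucauchy (fun n => geval (f n)) ->
  cconv (fun n => geval (f n) i) (geval (GLim f) i).
Proof.
move=> fC; rewrite /= asboolT//.
have [|l hl] := @cnorm_complete R (urep_alg i) (fun n => geval (f n) i).
  by move=> e /fC[N hN]; exists N => m n Nm Nn; apply: hN.
exact: (xgetI 0 hl).
Qed.

Lemma geval_bounded x : exists M : R, forall i, cnorm (geval x i) <= M.
Proof.
elim: x => [g|x [M hM] y [N hN]|x [M hM] y [N hN]|c x [M hM]|x [M hM]|f IH].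
- exists 1 => i; have [u1 uM uS] := urepP i.
  by rewrite /= cnorm_unitary// uS -uM mulVg.
- by exists (M + N) => i; apply: le_trans (ler_cnormD _ _) _; apply: lerD.
- exists (M * N) => i; apply: le_trans (ler_cnormM _ _) _.
  by apply: ler_pM; rewrite ?cnorm_ge0.
- exists (Normc.normc c * M) => i; rewrite /= cnormZ ler_wpM2l//.
  by case: (c) => a b; exact: sqrtr_ge0.
- by exists M => i; rewrite /= cnorm_star.
- have [fC|fC] := pselect (ucauchy (fun n => geval (f n))); last first.
    by exists 0 => i; rewrite /= asboolF// cnorm0.
  have [N hN] := fC 1 ltr01; have [M hM] := IH N.
  exists (M + 1 + 1) => i; have [K hK] := gevalLim i fC ltr01.
  have := hK _ (leq_maxr N K); have := hN _ N (leq_maxl N K) (leqnn _) i.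
  set a := geval (f (maxn _ _)) i; set b := geval (f N) i; set l := geval _ i.
  have := ler_cnormB l a b; have := ler_cnormB l b 0; rewrite !subr0 => h1 h2 h3 h4.
  have := hM i; rewrite cnorm_distC in h4; rewrite -/b; lra.
Qed.

HB.instance Definition _ := gen_eqMixin gexpr.
HB.instance Definition _ := gen_choiceMixin gexpr.

Definition gequiv (x y : gexpr) := `[< forall i, geval x i = geval y i >].

Let gequiv_refl : reflexive gequiv. Proof. by move=> x; apply/asboolP. Qed.
Let gequiv_sym : symmetric gequiv.
Proof. by move=> x y; apply/asboolP/asboolP => h i; rewrite h. Qed.
Let gequiv_trans : transitive gequiv.
Proof.
by move=> y x z /asboolP h /asboolP h'; apply/asboolP => i; rewrite h h'.
Qed.

Canonical gequiv_rel := EquivRel gequiv gequiv_refl gequiv_sym gequiv_trans.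

Definition group_cstar := {eq_quot gequiv_rel}.

HB.instance Definition _ := Choice.on group_cstar.
Implicit Types (x y z : group_cstar).

Definition gev x i : urep_alg i := geval (repr x) i.

Definition gpi (a : gexpr) : group_cstar := \pi_group_cstar a.

Lemma gev_pi (a : gexpr) i : gev (gpi a) i = geval a i.
Proof.
have : gequiv_rel (repr (gpi a)) a by apply/eqmodP; rewrite reprK.
by move/asboolP; apply.
Qed.

Lemma gev_inj x y : (forall i, gev x i = gev y i) -> x = y.
Proof.
move=> h; have : gequiv_rel (repr x) (repr y) by apply/asboolP.
by move/eqmodP; rewrite !reprK.
Qed.

Let g1 : group_cstar := gpi (GGen 1%g).
Let g0 : group_cstar := gpi (GScale 0 (GGen 1%g)).
Let gadd x y : group_cstar := gpi (GAdd (repr x) (repr y)).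
Let gmul x y : group_cstar := gpi (GMul (repr x) (repr y)).
Let gscale c x : group_cstar := gpi (GScale c (repr x)).
Let gopp x : group_cstar := gscale (-1) x.
Let gstar x : group_cstar := gpi (GStar (repr x)).

Let gev1 i : gev g1 i = 1.
Proof. by rewrite gev_pi /=; case: (urepP i). Qed.
Let gev0 i : gev g0 i = 0. Proof. by rewrite gev_pi /= scale0r. Qed.
Let gevD x y i : gev (gadd x y) i = gev x i + gev y i.
Proof. by rewrite gev_pi. Qed.
Let gevM x y i : gev (gmul x y) i = gev x i * gev y i.
Proof. by rewrite gev_pi. Qed.
Let gevZ c x i : gev (gscale c x) i = c *: gev x i.
Proof. by rewrite gev_pi. Qed.
Let gevN x i : gev (gopp x) i = - gev x i.
Proof. by rewrite gevZ scaleN1r. Qed.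
Let gevS x i : gev (gstar x) i = star (gev x i).
Proof. by rewrite gev_pi. Qed.

Let gaddA : associative gadd.
Proof. by move=> x y z; apply: gev_inj => i; rewrite !gevD addrA. Qed.
Let gaddC : commutative gadd.
Proof. by move=> x y; apply: gev_inj => i; rewrite !gevD addrC. Qed.
Let gadd0 : left_id g0 gadd.
Proof. by move=> x; apply: gev_inj => i; rewrite !gevD gev0 add0r. Qed.
Let gaddN : left_inverse g0 gopp gadd.
Proof. by move=> x; apply: gev_inj => i; rewrite !gevD gevN gev0 addNr. Qed.
HB.instance Definition _ :=
  GRing.isZmodule.Build group_cstar gaddA gaddC gadd0 gaddN.

Let gmulA : associative gmul.
Proof. by move=> x y z; apply: gev_inj => i; rewrite !gevM mulrA. Qed.
Let gmul1x : left_id g1 gmul.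
Proof. by move=> x; apply: gev_inj => i; rewrite !gevM gev1 mul1r. Qed.
Let gmulx1 : right_id g1 gmul.
Proof. by move=> x; apply: gev_inj => i; rewrite !gevM gev1 mulr1. Qed.
Let gmulDl : left_distributive gmul gadd.
Proof. by move=> x y z; apply: gev_inj => i; rewrite !(gevM, gevD) mulrDl. Qed.
Let gmulDr : right_distributive gmul gadd.
Proof. by move=> x y z; apply: gev_inj => i; rewrite !(gevM, gevD) mulrDr. Qed.

Let trivial_rep : unitary_rep (fun _ : G => 1 : R[i]^o).
Proof. by split => [|g h|g]; rewrite ?mulr1 ?star1. Qed.

Let g1_neq0 : g1 != g0.
Proof.
apply/eqP => /(congr1 (fun x => gev x (URep trivial_rep))).
by rewrite gev1 gev0 => /eqP; rewrite oner_eq0.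
Qed.
HB.instance Definition _ := GRing.Zmodule_isNzRing.Build group_cstar
  gmulA gmul1x gmulx1 gmulDl gmulDr g1_neq0.

Let gscaleA (a b : R[i]) x : gscale a (gscale b x) = gscale (a * b) x.
Proof. by apply: gev_inj => i; rewrite !gevZ scalerA. Qed.
Let gscale1 : left_id 1 gscale.
Proof. by move=> x; apply: gev_inj => i; rewrite !gevZ scale1r. Qed.
Let gscaleDr : right_distributive gscale +%R.
Proof. by move=> c x y; apply: gev_inj => i; rewrite !(gevZ, gevD) scalerDr. Qed.
Let gscaleDl x : {morph gscale^~ x : a b / a + b}.
Proof. by move=> a b; apply: gev_inj => i; rewrite !(gevZ, gevD) scalerDl. Qed.
HB.instance Definition _ := GRing.Zmodule_isLmodule.Build R[i] group_cstar
  gscaleA gscale1 gscaleDr gscaleDl.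

Let gscaleAl (c : R[i]) x y : c *: (x * y) = (c *: x) * y.
Proof. by apply: gev_inj => i; rewrite !(gevZ, gevM) scalerAl. Qed.
HB.instance Definition _ :=
  GRing.Lmodule_isLalgebra.Build R[i] group_cstar gscaleAl.
Let gscaleAr (c : R[i]) x y : c *: (x * y) = x * (c *: y).
Proof. by apply: gev_inj => i; rewrite !(gevZ, gevM) scalerAr. Qed.
HB.instance Definition _ :=
  GRing.Lalgebra_isAlgebra.Build R[i] group_cstar gscaleAr.

Let gnorm x : R := sup [set r | exists i, r = cnorm (gev x i)]%classic.

Let gnorm_hs x : has_sup [set r | exists i, r = cnorm (gev x i)]%classic.
Proof.
split; first by eexists; exists (URep trivial_rep).
by have [M hM] := geval_bounded (repr x); exists M => _ [i ->]; exact: hM.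
Qed.

Lemma gev_le x i : cnorm (gev x i) <= gnorm x.
Proof. by apply: sup_upper_bound; [exact: gnorm_hs|exists i]. Qed.

Let gnorm_le x r : (forall i, cnorm (gev x i) <= r) -> gnorm x <= r.
Proof.
by move=> h; apply: ge_sup; [case: (gnorm_hs x)|move=> _ [i ->]].
Qed.

Let gnorm_ge0 x : 0 <= gnorm x.
Proof. exact: le_trans (cnorm_ge0 _) (gev_le x (URep trivial_rep)). Qed.

Let gevB x y i : gev (x - y) i = gev x i - gev y i.
Proof. by rewrite gevD gevN. Qed.

Let gstarK : involutive gstar.
Proof. by move=> x; apply: gev_inj => i; rewrite !gevS starK. Qed.
Let gstarD : {morph gstar : x y / x + y}.
Proof. by move=> x y; apply: gev_inj => i; rewrite !(gevS, gevD) starD. Qed.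
Let gstarZ (c : R[i]) x : gstar (c *: x) = (c^*)%C *: gstar x.
Proof. by apply: gev_inj => i; rewrite !(gevS, gevZ) starZ. Qed.
Let gstarM x y : gstar (x * y) = gstar y * gstar x.
Proof. by apply: gev_inj => i; rewrite !(gevS, gevM) starM. Qed.
Let gnorm_eq0 x : gnorm x = 0 -> x = 0.
Proof.
move=> x0; apply: gev_inj => i; rewrite gev0; apply/cnorm_eq0/eqP.
by rewrite eq_le cnorm_ge0 andbT -x0 gev_le.
Qed.
Let gnormD x y : gnorm (x + y) <= gnorm x + gnorm y.
Proof.
apply: gnorm_le => i; rewrite gevD.
by rewrite (le_trans (ler_cnormD _ _))// lerD// gev_le.
Qed.
Let gnormZ (c : R[i]) x : gnorm (c *: x) = Normc.normc c * gnorm x.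
Proof.
have nge0 (d : R[i]) : 0 <= Normc.normc d by case: d => a b; exact: sqrtr_ge0.
have le d y : gnorm (d *: y) <= Normc.normc d * gnorm y.
  by apply: gnorm_le => i; rewrite gevZ cnormZ ler_wpM2l ?gev_le.
apply/eqP; rewrite eq_le le /=; have [->|c0] := eqVneq c 0.
  by rewrite Normc.normc0 mul0r.
have c1 : Normc.normc c != 0 by apply: contra c0 => /eqP/Normc.eq0_normc ->.
have c2 : 0 < Normc.normc c by rewrite lt_def c1 nge0.
rewrite mulrC -ler_pdivlMr// mulrC -Normc.normcV; apply: le_trans (le _ _).
by rewrite scalerA mulVf// scale1r.
Qed.
Let gnormM x y : gnorm (x * y) <= gnorm x * gnorm y.
Proof.
apply: gnorm_le => i; rewrite gevM (le_trans (ler_cnormM _ _))//.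
by rewrite ler_pM ?cnorm_ge0 ?gev_le.
Qed.
Let gnorm_star2 x : gnorm (gstar x * x) = gnorm x ^+ 2.
Proof.
apply/eqP; rewrite eq_le; apply/andP; split.
  apply: gnorm_le => i; rewrite gevM gevS cnorm_star2.
  by rewrite ler_pXn2r ?nnegrE ?cnorm_ge0 ?gev_le.
rewrite -ler_sqrt ?gnorm_ge0// sqrtr_sqr ger0_norm//.
apply: gnorm_le => i; rewrite -[leLHS]ger0_norm ?cnorm_ge0// -sqrtr_sqr.
rewrite ler_sqrt ?gnorm_ge0// -cnorm_star2; apply: le_trans (gev_le _ i).
by rewrite gevM gevS.
Qed.

Lemma gcauchy (u : nat -> group_cstar) :
  (forall e : R, 0 < e -> exists N, forall m n, (N <= m)%N -> (N <= n)%N ->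
     gnorm (u m - u n) < e) ->
  ucauchy (fun n => geval (repr (u n))).
Proof.
move=> uC e /uC[N hN]; exists N => m n Nm Nn i.
by apply: le_lt_trans (hN m n Nm Nn); rewrite -[X in cnorm X]gevB gev_le.
Qed.

Let gnorm_lim (s : nat -> gexpr) : ucauchy (fun n => geval (s n)) ->
  forall e : R, 0 < e -> exists N, forall n, (N <= n)%N ->
    gnorm (gpi (s n) - gpi (GLim s)) < e.
Proof.
move=> sC e e0; have e3 : 0 < e / 3 by rewrite divr_gt0.
have [N hN] := sC _ e3; exists N => n Nn.
apply: (@le_lt_trans _ _ (e / 3 + e / 3)); last by lra.
apply: gnorm_le => i; rewrite gevB !gev_pi.
have [M hM] := gevalLim i sC e3.
apply: le_trans (ler_cnormB _ (geval (s (maxn N M)) i) _) _.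
by rewrite lerD ?ltW ?hM ?hN ?leq_maxl ?leq_maxr.
Qed.

Let gnorm_complete (u : nat -> group_cstar) :
  (forall e : R, 0 < e -> exists N, forall m n, (N <= m)%N -> (N <= n)%N ->
     gnorm (u m - u n) < e) ->
  exists l, forall e : R, 0 < e -> exists N, forall n, (N <= n)%N ->
     gnorm (u n - l) < e.
Proof.
move=> uC; exists (gpi (GLim (fun n => repr (u n)))) => e e0.
have [N hN] := gnorm_lim (gcauchy uC) e0; exists N => n /hN.
by rewrite [gpi (repr _)]reprK.
Qed.

HB.instance Definition _ := @isCStar.Build R group_cstar gstar gstarK gstarD
  gstarZ gstarM gnorm gnorm_eq0 gnormD gnormZ gnormM gnorm_star2 gnorm_complete.

Definition group_unitary (g : G) : group_cstar := gpi (GGen g).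

Lemma group_unitary_rep : unitary_rep group_unitary.
Proof.
split => [//|g h|g]; apply: gev_inj => i; have [u1 uM uS] := urepP i.
- by rewrite gevM !gev_pi /= uM.
- by rewrite gevS !gev_pi /= uS.
Qed.

Lemma group_cstar_universal (A : cstarAlgType R) (pi : G -> A) :
  unitary_rep pi -> exists! f : group_cstar -> A,
    star_hom f /\ forall g, f (group_unitary g) = pi g.
Proof.
move=> piP; pose i := URep piP.
exists (fun x => gev x i); split.
  split=> [|g]; last by rewrite gev_pi.
  split=> [x y|c x|x y||x].
  - exact: (gevD x y i).
  - exact: (gevZ c x i).
  - exact: (gevM x y i).
  - exact: (gev1 i).
  - exact: (gevS x i).
move=> f [fH fg]; apply/funext => x; rewrite -[x]reprK -/(gpi _) gev_pi; symmetry.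
have [fD fZ fM f1 fS] := fH.
elim: (repr x) => [g|a IHa b IHb|a IHa b IHb|c a IHa|a IHa|s IH] /=.
- exact: fg.
- rewrite -IHa -IHb -fD; congr f; apply: gev_inj => j.
  by rewrite gevD !gev_pi.
- rewrite -IHa -IHb -fM; congr f; apply: gev_inj => j.
  by rewrite gevM !gev_pi.
- rewrite -IHa -fZ; congr f; apply: gev_inj => j.
  by rewrite gevZ !gev_pi.
- rewrite -IHa -fS; congr f; apply: gev_inj => j.
  by rewrite gevS !gev_pi.
- have [sC|sC] := pselect (ucauchy (fun n => geval (s n))); last first.
    rewrite asboolF//; have <- : f 0 = 0.
      by have := fZ 0 1; rewrite !scale0r.
    congr f; apply: gev_inj => j; rewrite gev_pi gev0 /= asboolF//.
  have eL : geval (GLim s) i = f (gpi (GLim s)).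
    apply: (cconv_unique (gevalLim i sC)) => e /(gnorm_lim sC)[N hN].
    exists N => n /hN; apply: le_lt_trans; rewrite -IH.
    have fB a b : f (a - b) = f a - f b.
      by rewrite fD -scaleN1r fZ scaleN1r.
    by rewrite -fB; apply: star_hom_contractive.
  by rewrite -eL.
Qed.

End MaximalGroupCStar.
(* The free product of n copies of Z/2, realised as the group of words in which
   no two consecutive letters are equal. *)
Section Z2Free.
Variable n : nat.
Implicit Types (i j : 'I_n) (s t : seq 'I_n).

Definition reduced s := sorted [rel i j | i != j] s.

Definition Z2free := {s : seq 'I_n | reduced s}.
HB.instance Definition _ := Choice.on Z2free.

Definition push i s :=
  if s is j :: t then if i == j then t else i :: s else [:: i].

Lemma push_reduced i s : reduced s -> reduced (push i s).
Proof.
case: s => //= j s; case: eqVneq => [_|ij]; last by rewrite /= ij.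
exact: path_sorted.
Qed.

Lemma pushK i s : reduced s -> push i (push i s) = s.
Proof.
case: s => /= [_|j s]; first by rewrite eqxx.
case: (eqVneq i j) => [<-|ij] /=; last by rewrite eqxx.
by case: s => //= k s /andP[/negPf ->].
Qed.

Lemma foldr_push_reduced s t : reduced t -> reduced (foldr push t s).
Proof. by move=> t_red; elim: s => //= i s; apply: push_reduced. Qed.

Lemma foldr_push s t i : reduced t ->
  foldr push t (push i s) = push i (foldr push t s).
Proof.
move=> t_red; case: s => //= j s; case: eqVneq => [<-|//].
by rewrite pushK// foldr_push_reduced.
Qed.

Lemma foldr_push_nil s : reduced s -> foldr push [::] s = s.
Proof.
elim: s => //= i s IH s_red; rewrite (IH (path_sorted s_red)).
by case: s s_red {IH} => //= j s /andP[/negPf ->].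
Qed.

Lemma reduced_rev s : reduced s -> reduced (rev s).
Proof.
rewrite /reduced rev_sorted; apply: sub_sorted => i j /=.
by rewrite eq_sym.
Qed.

Definition Z2one : Z2free := exist _ [::] isT.
Definition Z2mul (v w : Z2free) : Z2free :=
  exist _ (foldr push (val w) (val v)) (foldr_push_reduced _ (valP w)).
Definition Z2inv (v : Z2free) : Z2free :=
  exist _ (rev (val v)) (reduced_rev (valP v)).
Definition Z2gen i : Z2free := exist _ [:: i] isT.

Let Z2mulA : associative Z2mul.
Proof.
move=> [x xr] [y yr] [z zr]; apply: val_inj => /=.
by elim: x {xr} => //= i x ->; rewrite foldr_push.
Qed.
Let Z2mul1 : left_id Z2one Z2mul.
Proof. by move=> x; apply: val_inj. Qed.
Let Z2mulr1 : right_id Z2one Z2mul.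
Proof. by move=> [x xr]; apply: val_inj; exact: foldr_push_nil. Qed.
Let foldr_push_rev s t : reduced t -> foldr push (foldr push t s) (rev s) = t.
Proof.
move=> t_red; elim: s => //= i s IH; rewrite rev_cons -cats1 foldr_cat /=.
by rewrite pushK ?foldr_push_reduced.
Qed.
Let Z2mulV : left_inverse Z2one Z2inv Z2mul.
Proof.
move=> [x xr]; apply: val_inj => /=.
by have := foldr_push_rev x (isT : reduced [::]); rewrite foldr_push_nil.
Qed.
Let Z2mulrV : right_inverse Z2one Z2inv Z2mul.
Proof.
move=> [x xr]; apply: val_inj => /=.
have := foldr_push_rev (rev x) (isT : reduced [::]).
by rewrite foldr_push_nil ?revK// reduced_rev.
Qed.
HB.instance Definition _ :=
  isGroup.Build Z2free Z2mulA Z2mul1 Z2mulr1 Z2mulV Z2mulrV.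

Lemma reduced_perm (s : 'S_n) (w : Z2free) : reduced (map s (val w)).
Proof.
case: w => w /=; rewrite /reduced sorted_map; apply: sub_sorted => i j /=.
by rewrite (inj_eq perm_inj).
Qed.

Definition Z2perm (s : 'S_n) (w : Z2free) : Z2free :=
  exist _ (map s (val w)) (reduced_perm s w).

End Z2Free.

Section CMQG.
Variable R : realType.
Implicit Types (A B M T : cstarAlgType R) (n : nat).

Definition star_subalgebra A (S : set A) :=
  [/\ S 1, forall x y, S x -> S y -> S (x + y),
      forall (c : R[i]) x, S x -> S (c *: x),
      forall x y, S x -> S y -> S (x * y) & forall x, S x -> S (star x)].

Definition cclosed A (S : set A) :=
  forall (v : nat -> A) x, (forall k, S (v k)) -> cconv v x -> S x.

Definition star_hom_on A B (S : set A) (f : A -> B) :=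
  [/\ forall x y, S x -> S y -> f (x + y) = f x + f y,
      forall (c : R[i]) x, S x -> f (c *: x) = c *: f x,
      forall x y, S x -> S y -> f (x * y) = f x * f y,
      f 1 = 1 & forall x, S x -> f (star x) = star (f x)].

Definition lin_indep A m (b : 'I_m -> A) :=
  forall c : 'I_m -> R[i], \sum_k c k *: b k = 0 -> forall k, c k = 0.

(* i1 and i2 induce an injective *-homomorphism of the algebraic tensor product
   of A and B into T, i.e. a C*-norm on this tensor product. *)
Definition tensor_embedding A B T (i1 : A -> T) (i2 : B -> T) :=
  [/\ star_hom i1, star_hom i2, forall a b, i1 a * i2 b = i2 b * i1 a &
      forall m (a : 'I_m -> A) (b : 'I_m -> B), lin_indep b ->
        \sum_k i1 (a k) * i2 (b k) = 0 -> forall k, a k = 0].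

(* T is the minimal (spatial) tensor product of A and B: the completion of the
   algebraic tensor product in its smallest C*-norm. *)
Definition min_tensor A B T (i1 : A -> T) (i2 : B -> T) :=
  [/\ tensor_embedding i1 i2,
      forall (t : T) (e : R), 0 < e -> exists m (a : 'I_m -> A) (b : 'I_m -> B),
        cnorm (t - \sum_k i1 (a k) * i2 (b k)) < e &
      forall T' (j1 : A -> T') (j2 : B -> T'), tensor_embedding j1 j2 ->
        forall m (a : 'I_m -> A) (b : 'I_m -> B),
          cnorm (\sum_k i1 (a k) * i2 (b k)) <=
          cnorm (\sum_k j1 (a k) * j2 (b k))].

Definition comultiplication A n (u : 'M[A]_n) T (i1 i2 : A -> T)
    (Delta : A -> T) :=
  star_hom Delta /\
  forall i j, Delta (u i j) = \sum_k i1 (u i k) * i2 (u k j).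

Definition is_CMQG A n (u : 'M[A]_n) :=
  let ustar := \matrix_(i, j) star (u j i) in
  [/\ u *m ustar = 1%:M /\ ustar *m u = 1%:M,
      forall S : set A, star_subalgebra S -> cclosed S ->
        (forall i j, S (u i j)) -> forall x, S x,
      exists T (i1 i2 : A -> T), min_tensor i1 i2 /\
        exists Delta, comultiplication u i1 i2 Delta &
      exists v : 'M[A]_n, u^T *m v = 1%:M /\ v *m u^T = 1%:M].

Definition CMQG_iso n A (u : 'M[A]_n) B (w : 'M[B]_n) :=
  exists f : A -> B,
    [/\ star_hom f, bijective f & forall i j, f (u i j) = w i j].

Definition Pol A n (u : 'M[A]_n) : set A := fun x =>
  forall S : set A, star_subalgebra S -> (forall i j, S (u i j)) -> S x.

(* (M, w) is the universal enveloping C*-algebra of Pol(A), with the image of u.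
   The values of [iota] and [f] outside Pol(A) are irrelevant. *)
Definition maximal_version n A (u : 'M[A]_n) M (w : 'M[M]_n) :=
  exists iota : A -> M,
    [/\ star_hom_on (Pol u) iota, forall i j, iota (u i j) = w i j &
        forall B (f : A -> B), star_hom_on (Pol u) f ->
          exists! g : M -> B,
            star_hom g /\ forall x, Pol u x -> g (iota x) = f x].

Definition in_maximal_version n A (u : 'M[A]_n) :=
  exists M (w : 'M[M]_n), maximal_version u w /\ CMQG_iso u w.

Definition version_of n A (u : 'M[A]_n) B (w : 'M[B]_n) :=
  in_maximal_version w /\
  exists M (v : 'M[M]_n), maximal_version u v /\ CMQG_iso v w.

Definition perm_fun n (i j : 'I_n) : SnFun n R[i]^o :=
  [ffun s : 'S_n => (s j == i)%:R].

(* u_ij is mapped to p_ij itself, not merely to the entries of a GL_n(C)-conjugate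
   of p. With conjugation allowed, the results one expects for homogeneous
   quantum groups fail: let G be the group of the 4x4 matrices diag(e, t), where
   e = 1 or -1 and t is one of the 24 signed permutation matrices preserving a
   regular tetrahedron. The t form the standard representation of S_4, so G
   contains a conjugate of S_4, but G is not conjugate to Z/2 x S_4 = {e s}. *)
Definition homogeneous A n (u : 'M[A]_n) :=
  exists f : A -> SnFun n R[i]^o,
    star_hom f /\ forall i j, f (u i j) = perm_fun i j.

Definition central_projection A (p : A) :=
  [/\ p * p = p, star p = p & forall x, p * x = x * p].

Definition tensor_fun A n (a : A) (f : SnFun n R[i]^o) : SnFun n A :=
  [ffun s => (f s : R[i]) *: a].

(* The fundamental corepresentation of C*(G) |><| C(S_n). *)
Definition bowtie n (G : groupType) (g : 'I_n -> G) :
    'M[SnFun n (group_cstar R G)]_n :=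
  \matrix_(i, j) tensor_fun (group_unitary R (g i)) (perm_fun i j).

End CMQG.

(* Main.v *)
(* Write p_ij = u_ij^2. The p_ij are central projections forming a magic unitary, so
   the products P_s = p_(s 1)1 ... p_(s n)n, for s in S_n, are orthogonal central
   projections with sum 1; the a_i = sum_j u_ij are symmetries and u_ij = a_i p_ij.
   Let Gamma be the group of words in the a_i, inside A. Then Pol(A) is spanned by
   the g P_s with g in Gamma, and everything reduces to the linear independence of
   these elements.
   For a word w, Delta(w) = sum_s w P_s (x) s^-1(w) and Delta(P_s) =
   sum_r P_r (x) P_(s r^-1) (composition of maps: r^-1 s). Slicing the second leg with
   the characters A -> C(S_n) -> C shows that x P_s = 0 implies x = 0 for x in the span
   of Gamma. Then, if sum_g c_g g = 0, the 1-component of Delta gives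
   sum_g c_g (g - h) P_1 (x) g = 0 for each h, so Dedekind's argument for the
   independence of characters applies to Gamma. The same component formula gives the
   invariance of the kernel of Z_2^{*n} -> Gamma. *)
From HB Require Import structures.
Require Import Defs.
From mathcomp Require Import all_boot all_order all_algebra perm.
From mathcomp Require Import all_classical all_reals complex.

Set Implicit Arguments.
Unset Strict Implicit.
Unset Printing Implicit Defensive.

Import Order.TTheory GRing.Theory Num.Theory.
Local Open Scope ring_scope.

(** * Central idempotents and magic matrices *)

Section CentralIdempotents.
Variables (K : numFieldType) (A : algType K).
Implicit Types (e x : A).

Definition central_idempotent e := e * e = e /\ forall x, e * x = x * e.

Lemma prod_central_idempotent (I : Type) (s : seq I) (q : I -> A) :
  (forall i, central_idempotent (q i)) ->
  central_idempotent (\prod_(i <- s) q i).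
Proof.
move=> qP; apply: (big_ind central_idempotent) => [|d e [dd dC] [ee eC]|i _ //].
  by split=> [|x]; rewrite !mul1r ?mulr1.
split=> [|x]; last by rewrite -mulrA eC mulrA dC mulrA.
by rewrite -mulrA [e * _]mulrA -[e * d]dC !mulrA dd -mulrA ee.
Qed.

Lemma prod_idempotent_mul (I : eqType) (s : seq I) (q : I -> A) i :
  (forall j, central_idempotent (q j)) -> i \in s ->
  (\prod_(j <- s) q j) * q i = \prod_(j <- s) q j.
Proof.
move=> qP; elim: s => // j s IH; rewrite inE big_cons.
have [<- _|_ /IH h] := eqVneq i j; last by rewrite -mulrA h.
by have [qq qC] := qP i; rewrite -mulrA -qC mulrA qq.
Qed.

(** Positivity of a sum of idempotents, made algebraic: multiplying by [q i] turns the summand [q i]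
    into 1, so induction with [m.+1] for [m] gives [q i * e = 0], and [q i] drops out of the sum. *)
Lemma nat_add_sum_idempotent_eq0 (I : Type) (s : seq I) (q : I -> A) m e :
  (forall i, central_idempotent (q i)) ->
  (m.+1%:R + \sum_(i <- s) q i) * e = 0 -> e = 0.
Proof.
move=> qP; elim: s m e => [|i s IH] m e.
  rewrite big_nil addr0 mulr_natl -scaler_nat => /eqP.
  by rewrite scaler_eq0 pnatr_eq0 => /eqP.
rewrite big_cons; set S := \sum_(_ <- _) _; have [qq qC] := qP i => h.
have qe : q i * e = 0.
  apply: (IH m.+1); rewrite -/S -[RHS](mulr0 (q i)) -h.
  rewrite [in RHS]mulrA [in RHS]qC -[in RHS]mulrA.
  by rewrite -[in LHS]natr1 !mulrDl mul1r [q i * (q i * e)]mulrA qq !addrA.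
by apply: (IH m); rewrite -[RHS]h !mulrDl qe add0r.
Qed.

(** Multiplying the sum by [e = q i * q j] gives e + e + (the other terms) = e, so 1 plus the sum of
    the other idempotents annihilates [e]. *)
Lemma partition_of_unity_orthogonal (I : finType) (q : I -> A) :
  (forall i, central_idempotent (q i)) -> \sum_i q i = 1 ->
  forall i j, i != j -> q i * q j = 0.
Proof.
move=> qP q1 i j ij; set e := q i * q j.
have [[qi qiC] [qj qjC]] := (qP i, qP j).
pose s := [seq k <- index_enum I | (k != i) && (k != j)].
apply: (@nat_add_sum_idempotent_eq0 _ s q 0) => //.
apply: (addrI e); rewrite addr0 mulrDl mul1r -[in RHS](mul1r e) -q1.
rewrite (bigD1 i)//= (bigD1 j) 1?eq_sym//= -[in RHS]big_filter -/s !mulrDl.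
have -> : q i * e = e by rewrite /e mulrA qi.
by have -> : q j * e = e by rewrite /e qjC -mulrA qj.
Qed.

End CentralIdempotents.

Section MagicMatrix.
Variables (K : numFieldType) (A : algType K) (n : nat).
Variable p : 'I_n -> 'I_n -> A.
Hypothesis pP : forall i j, central_idempotent (p i j).
Hypothesis p_row : forall i, \sum_j p i j = 1.
Hypothesis p_col : forall j, \sum_i p i j = 1.

Definition perm_idempotent (s : 'S_n) : A := \prod_j p (s j) j.
Local Notation P := perm_idempotent.

Lemma perm_idempotentC s x : P s * x = x * P s.
Proof.
by have [_ ->] := prod_central_idempotent (index_enum 'I_n) (fun j => pP (s j) j).
Qed.

Lemma perm_idempotent_mul_entry s i j : P s * p i j = P s *+ (s j == i).
Proof.
have h : P s * p (s j) j = P s.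
  exact: (prod_idempotent_mul (fun k => pP (s k) k) (mem_index_enum j)).
case: eqVneq => [<-|sji]; first by rewrite h mulr1n.
rewrite -h -mulrA (partition_of_unity_orthogonal (q := p^~ j))// ?mulr0//.
Qed.

(** Each factor of [P t] is absorbed by [P s], or annihilates it if it belongs to a column where [s]
    and [t] differ. *)
Lemma perm_idempotentM s t : P s * P t = P s *+ (s == t).
Proof.
have -> : (s == t) = all (fun j => s j == t j) (index_enum 'I_n).
  apply/eqP/allP => [-> j _ //|h]; apply/permP => j.
  by apply/eqP/h/mem_index_enum.
rewrite {2}/P; elim: (index_enum _) => [|j r IH]; first by rewrite big_nil mulr1.
rewrite big_cons mulrA perm_idempotent_mul_entry mulrnAl IH /=.
by case: (s j == _); rewrite //= mulr0n.
Qed.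

(** The product of the column sums expands over all maps [f] from columns to rows; the injective
    ones are the permutations. *)
Lemma sum_perm_idempotent : \sum_s P s = 1.
Proof.
have -> : 1 = \prod_(j < n) \sum_i p i j.
  by under eq_bigr do rewrite p_col; rewrite big1_eq.
rewrite bigA_distr_bigA (bigID (fun f : {ffun 'I_n -> 'I_n} => injectiveb f)) /=.
rewrite [X in _ + X]big1 ?addr0 => [|f].
  rewrite (reindex (@pval _)) /=; last first.
    pose in_Sn := insubd (1%g : 'S_n).
    by exists in_Sn => /= f Uf; first apply: val_inj; apply: insubdK.
  apply: eq_big => /= [s | s _]; first by rewrite (valP s).
  by apply: eq_bigr => j _; rewrite pvalE.
(* A repeated value of [f] puts two distinct entries of one row into the product, and these are
   orthogonal. *)
move=> /injectivePn[j [k jk fjk]].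
have h l := prod_idempotent_mul (fun k => pP (f k) k) (mem_index_enum l).
rewrite -(h j) -(h k) -mulrA -fjk.
by rewrite (partition_of_unity_orthogonal (q := p (f j)))// ?mulr0// eq_sym.
Qed.

Lemma entry_sum_perm_idempotent i j : p i j = \sum_s P s *+ (s j == i).
Proof.
rewrite -[LHS]mul1r -sum_perm_idempotent mulr_suml.
by apply: eq_bigr => s _; rewrite perm_idempotent_mul_entry.
Qed.

End MagicMatrix.

(** The [Q s] cut out orthogonal blocks. This computes both products of values of [Delta] and
    products under homomorphisms out of C*(G) (x) C(S_n). *)
Lemma blockM (B : pzRingType) (I : finType) (Q x y : I -> B) :
  (forall s t, Q s * Q t = Q s *+ (s == t)) ->
  (forall s t, Q s * y t = y t * Q s) ->
  (\sum_s x s * Q s) * (\sum_s y s * Q s) = \sum_s x s * y s * Q s.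
Proof.
move=> QQ Qy; rewrite mulr_suml; apply: eq_bigr => s _.
rewrite mulr_sumr (bigD1 s)//= big1 ?addr0 => [|t ts].
  by rewrite -mulrA [Q s * _]mulrA Qy -[y s * _ * _]mulrA QQ eqxx !mulrA.
by rewrite -mulrA [Q s * _]mulrA Qy -[y t * _ * _]mulrA QQ eq_sym (negPf ts) !mulr0.
Qed.

(** * Star-homomorphisms and slices *)

Section StarMorphisms.
Variable R : realType.
Implicit Types (A B D T : cstarAlgType R) (n : nat).

Lemma star_hom_comp A B D (f : A -> B) (g : B -> D) :
  star_hom f -> star_hom g -> star_hom (g \o f).
Proof.
move=> [fD fZ fM f1 fS] [gD gZ gM g1 gS]; split=> [x y|c x|x y||x] /=.
- by rewrite fD gD.
- by rewrite fZ gZ.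
- by rewrite fM gM.
- by rewrite f1 g1.
- by rewrite fS gS.
Qed.

Lemma star_hom_id A : star_hom (@id A).
Proof. by split. Qed.

Lemma star_hom0 A B (f : A -> B) : star_hom f -> f 0 = 0.
Proof. by move=> [_ fZ _ _ _]; have := fZ 0 0; rewrite !scale0r. Qed.

Lemma star_hom_sum A B (f : A -> B) : star_hom f ->
  forall (I : Type) (r : seq I) (P : pred I) (F : I -> A),
  f (\sum_(i <- r | P i) F i) = \sum_(i <- r | P i) f (F i).
Proof.
move=> fH I r P F; apply: (big_morph f); last exact: star_hom0.
by case: fH.
Qed.

Lemma star_hom_prod A B (f : A -> B) : star_hom f ->
  forall (I : Type) (r : seq I) (P : pred I) (F : I -> A),
  f (\prod_(i <- r | P i) F i) = \prod_(i <- r | P i) f (F i).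
Proof. by move=> [fD fZ fM f1 fS] I r P F; apply: (big_morph f). Qed.

Lemma star_sum A (I : Type) (r : seq I) (F : I -> A) :
  star (\sum_(i <- r) F i) = \sum_(i <- r) star (F i).
Proof. by apply: (big_morph (@star R A)); [exact: starD|exact: star0]. Qed.

Lemma star_subalgebra0 A (S : set A) : star_subalgebra S -> S 0.
Proof. by move=> [S1 _ SZ _ _]; rewrite -(scale0r 1); exact: SZ. Qed.

Lemma star_subalgebra_sum A (S : set A) : star_subalgebra S ->
  forall (I : Type) (r : seq I) (F : I -> A), (forall i, S (F i)) ->
  S (\sum_(i <- r) F i).
Proof.
move=> SA I r F SF; apply: big_ind => //; first exact: star_subalgebra0.
by case: SA.
Qed.

Lemma star_subalgebra_prod A (S : set A) : star_subalgebra S ->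
  forall (I : Type) (r : seq I) (F : I -> A), (forall i, S (F i)) ->
  S (\prod_(i <- r) F i).
Proof. by move=> [S1 SD SZ SM SS] I r F SF; apply: big_ind. Qed.

Lemma star_hom_on_sum A B (S : set A) (f : A -> B) :
  star_subalgebra S -> star_hom_on S f ->
  forall (I : Type) (r : seq I) (F : I -> A), (forall i, S (F i)) ->
  f (\sum_(i <- r) F i) = \sum_(i <- r) f (F i).
Proof.
move=> SA [fD fZ fM f1 fS] I r F SF; have S0 := star_subalgebra0 SA.
elim: r => [|i r IH]; first by rewrite !big_nil -(scale0r 0) fZ ?scale0r.
by rewrite !big_cons fD ?IH//; exact: star_subalgebra_sum.
Qed.

Lemma Pol_star_subalgebra n A (u : 'M[A]_n) : star_subalgebra (Pol u).
Proof.
split=> [S|x y px py S|c x px S|x y px py S|x px S] SA Su;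
  have [S1 SD SZ SM SS] := SA => //.
- by apply: SD; [exact: px|exact: py].
- by apply: SZ; exact: px.
- by apply: SM; [exact: px|exact: py].
- by apply: SS; exact: px.
Qed.

Lemma Pol_gen n A (u : 'M[A]_n) i j : Pol u (u i j).
Proof. by move=> S _; apply. Qed.

(** Well-definedness of the slice map id (x) phi. If the [y k] are independent, the [x k] vanish;
    otherwise some [y k] is a combination of the others, its term is absorbed into theirs, and
    induction on [m] applies. *)
Lemma tensor_slice_ord A B T (i1 : A -> T) (i2 : B -> T) (phi : B -> R[i]^o) m
    (x : 'I_m -> A) (y : 'I_m -> B) :
  tensor_embedding i1 i2 -> star_hom phi ->
  \sum_k i1 (x k) * i2 (y k) = 0 -> \sum_k (phi (y k) : R[i]) *: x k = 0.
Proof.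
move=> [h1 h2 i12 inj] phiH.
have [phiD phiZ _ _ _] := phiH; have [i1D i1Z _ _ _] := h1.
elim: m x y => [|m IH] x y xy0; first by rewrite big_ord0.
have [yI|/existsNP[c /not_implyP[cy /existsNP[k ck]]]] := pselect (lin_indep y).
  by apply: big1 => k _; rewrite (inj _ _ _ yI xy0) scaler0.
have {}ck : c k != 0 by apply/eqP.
pose d j := - ((c k)^-1 * c (lift k j)).
have yk : y k = \sum_j d j *: y (lift k j).
  have -> : \sum_j d j *: y (lift k j) =
      - ((c k)^-1 *: \sum_j c (lift k j) *: y (lift k j)).
    rewrite scaler_sumr -sumrN; apply: eq_bigr => j _.
    by rewrite scalerA -scaleNr.
  move: cy; rewrite (bigD1_ord k)//= => /eqP; rewrite addrC addr_eq0 => /eqP ->.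
  by rewrite scalerN opprK scalerA mulVf// scale1r.
have phik : (phi (y k) : R[i]) = \sum_j d j * (phi (y (lift k j)) : R[i]).
  by rewrite yk (star_hom_sum phiH); apply: eq_bigr => j _; rewrite phiZ.
have := IH (fun j => x (lift k j) + d j *: x k) (fun j => y (lift k j)).
rewrite (bigD1_ord k)//= phik scaler_suml -big_split /= => h.
rewrite -[RHS]h; last first.
  rewrite -[RHS]xy0 (bigD1_ord k)//= yk (star_hom_sum h2) mulr_sumr -big_split /=.
  apply: eq_bigr => j _; rewrite i1D i1Z mulrDl addrC -scalerAl.
  by have [_ -> _ _ _] := h2; rewrite scalerAr.
by apply: eq_bigr => j _; rewrite scalerDr scalerA addrC [d j * _]mulrC.
Qed.

(* Slicing by [phi] on the algebraic tensor product only: boundedness of the slice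
   map for the minimal norm is not needed. *)
Lemma tensor_slice A B T (i1 : A -> T) (i2 : B -> T) (phi : B -> R[i]^o)
    (I : finType) (x : I -> A) (y : I -> B) :
  tensor_embedding i1 i2 -> star_hom phi ->
  \sum_k i1 (x k) * i2 (y k) = 0 -> \sum_k (phi (y k) : R[i]) *: x k = 0.
Proof.
rewrite [X in X = 0 -> _]big_enum_val [X in _ -> X = _]big_enum_val => iP phiP.
exact: (tensor_slice_ord (x := fun k => x (enum_val k)) (y := fun k => y (enum_val k))).
Qed.

End StarMorphisms.

(** * The algebra C[G] (x) C^I and its representations *)

Section GroupTimesPartition.
Variables (R : realType) (G : groupType) (I : finType).
Implicit Types (A B : cstarAlgType R).

(* A representation of the algebraic tensor product C[G] (x) C^I. *)
Definition rep_system B (pi : G -> B) (Q : I -> B) :=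
  [/\ unitary_rep pi, forall s t, Q s * Q t = Q s *+ (s == t), \sum_s Q s = 1,
      forall s, star (Q s) = Q s & forall g s, pi g * Q s = Q s * pi g].

(** The image of a formal sum of tensors g (x) e_s. Repeated pairs are allowed, so sums and products
    need no normal form. *)
Definition combo B (pi : G -> B) (Q : I -> B) (J : finType) (c : J -> R[i])
    (g : J -> G) (s : J -> I) : B :=
  \sum_j c j *: (pi (g j) * Q (s j)).

(** Both elements are images of one formal sum. This is kept as a relation until [combo_eq0] makes
    it the graph of a map. *)
Definition corresponds A (pi : G -> A) (Q : I -> A) B (rho : G -> B)
    (T : I -> B) (x : A) (y : B) :=
  exists (J : finType) (c : J -> R[i]) g s,
    x = combo pi Q c g s /\ y = combo rho T c g s.

Section Combo.
Variables (B : cstarAlgType R) (pi : G -> B) (Q : I -> B).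
Hypothesis piQ : rep_system pi Q.
Variables (J J' : finType) (c : J -> R[i]) (c' : J' -> R[i]).
Variables (g : J -> G) (g' : J' -> G) (s : J -> I) (s' : J' -> I).

Lemma combo1 : 1 = combo pi Q (fun=> 1) (fun=> 1%g) id.
Proof.
have [[pi1 _ _] _ Q1 _ _] := piQ; rewrite -Q1; apply: eq_bigr => t _.
by rewrite pi1 scale1r mul1r.
Qed.

Lemma comboD : combo pi Q c g s + combo pi Q c' g' s' =
  combo pi Q (fun j => match j with inl j => c j | inr j => c' j end)
    (fun j => match j with inl j => g j | inr j => g' j end)
    (fun j => match j with inl j => s j | inr j => s' j end).
Proof. by rewrite /combo big_sumType. Qed.

Lemma comboZ a : a *: combo pi Q c g s = combo pi Q (fun j => a * c j) g s.
Proof. by rewrite scaler_sumr; apply: eq_bigr => j _; rewrite scalerA. Qed.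

Lemma comboM : combo pi Q c g s * combo pi Q c' g' s' =
  combo pi Q (fun j : J * J' => (c j.1 * c' j.2) *+ (s j.1 == s' j.2))
    (fun j => (g j.1 * g' j.2)%g) (fun j => s j.1).
Proof.
have [[_ piM _] QQ _ _ piC] := piQ.
rewrite /combo mulr_suml; under eq_bigr do rewrite mulr_sumr.
rewrite pair_big; apply: eq_bigr => -[j j'] _ /=.
rewrite -scalerAl -scalerAr scalerA -mulrA [Q _ * _]mulrA -piC -[_ * _ * Q _]mulrA.
by rewrite QQ piM; case: eqP => _; rewrite ?mulr1n ?mulrA// !mulr0 scaler0 scale0r.
Qed.

Lemma combo_star : star (combo pi Q c g s) =
  combo pi Q (fun j => (c j)^*%C) (fun j => (g j)^-1%g) s.
Proof.
have [[_ piM piS] _ _ QS piC] := piQ.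
rewrite star_sum; apply: eq_bigr => j _.
by rewrite starZ starM QS piS piC.
Qed.

End Combo.

Section Corresponds.
Variables (A B : cstarAlgType R) (pi : G -> A) (Q : I -> A).
Variables (rho : G -> B) (T : I -> B).
Hypotheses (piQ : rep_system pi Q) (rhoT : rep_system rho T).
Local Notation corr := (corresponds pi Q rho T).

Lemma corresponds1 : corr 1 1.
Proof. by do 4 eexists; split; exact: combo1. Qed.

Lemma correspondsD x x' y y' : corr x y -> corr x' y' -> corr (x + x') (y + y').
Proof.
move=> [J [c [g [s [-> ->]]]]] [J' [c' [g' [s' [-> ->]]]]].
by do 4 eexists; split; exact: comboD.
Qed.

Lemma correspondsZ a x y : corr x y -> corr (a *: x) (a *: y).
Proof.
by move=> [J [c [g [s [-> ->]]]]]; do 4 eexists; split; exact: comboZ.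
Qed.

Lemma correspondsM x x' y y' : corr x y -> corr x' y' -> corr (x * x') (y * y').
Proof.
move=> [J [c [g [s [-> ->]]]]] [J' [c' [g' [s' [-> ->]]]]].
by do 4 eexists; split; exact: comboM.
Qed.

Lemma corresponds_star x y : corr x y -> corr (star x) (star y).
Proof.
by move=> [J [c [g [s [-> ->]]]]]; do 4 eexists; split; exact: combo_star.
Qed.

Lemma corresponds_rep g : corr (pi g) (rho g).
Proof.
have [_ _ Q1 _ _] := piQ; have [_ _ T1 _ _] := rhoT.
exists I, (fun=> 1), (fun=> g), id; rewrite -[pi g]mulr1 -[rho g]mulr1 -Q1 -T1.
by rewrite !mulr_sumr; split; apply: eq_bigr => s _; rewrite scale1r.
Qed.

Lemma corresponds_idem s : corr (Q s) (T s).
Proof.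
have [[pi1 _ _] _ _ _ _] := piQ; have [[rho1 _ _] _ _ _ _] := rhoT.
exists unit, (fun=> 1), (fun=> 1%g), (fun=> s); rewrite /combo !big_const.
by rewrite card_unit /= !addr0 !scale1r pi1 rho1 !mul1r.
Qed.

Hypothesis combo_eq0 : forall (J : finType) (c : J -> R[i]) g s,
  combo pi Q c g s = 0 -> combo rho T c g s = 0.

Lemma corresponds_fun x y y' : corr x y -> corr x y' -> y = y'.
Proof.
move=> xy /(correspondsZ (-1)) /(correspondsD xy); rewrite !scaleN1r subrr.
case=> J [c [g [s [/esym/combo_eq0 -> /eqP]]]].
by rewrite subr_eq0 => /eqP.
Qed.

(** The relation is functional and compatible with all operations, so choosing the related element,
    and 0 where there is none, gives a homomorphism on [S]. *)
Lemma star_hom_on_corresponds (S : set A) : star_subalgebra S ->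
  (forall x, S x -> exists y, corr x y) ->
  exists iota : A -> B, star_hom_on S iota /\
    forall x y, corr x y -> iota x = y.
Proof.
move=> [S1 SD SZ SM SS] Sdom; pose iota x := xget 0 [set y | corr x y]%classic.
have iotaE x y : corr x y -> iota x = y.
  by move=> xy; apply: corresponds_fun (xy); rewrite /iota; exact: (xgetI 0 xy).
have iotaP x : S x -> corr x (iota x).
  by move=> /Sdom[y xy]; rewrite (iotaE _ _ xy).
exists iota; split=> //.
split=> [x y /iotaP Sx /iotaP Sy|c x /iotaP Sx|x y /iotaP Sx /iotaP Sy||x /iotaP Sx];
  apply: iotaE.
- exact: correspondsD.
- exact: correspondsZ.
- exact: correspondsM.
- exact: corresponds1.
- exact: corresponds_star.
Qed.

End Corresponds.
End GroupTimesPartition.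

(** * Constants and point masses in C(S_n, A) *)

Section SnFunTheory.
Variables (R : realType) (n : nat) (A : cstarAlgType R).
Implicit Types (f g : SnFun n A) (s : 'S_n).

Lemma SnFunM f g s : (f * g) s = f s * g s. Proof. exact: ffunE. Qed.
Lemma SnFun1 s : (1 : SnFun n A) s = 1. Proof. exact: ffunE. Qed.
Lemma SnFunD f g s : (f + g) s = f s + g s. Proof. exact: ffunE. Qed.
Lemma SnFunZ (c : R[i]) f s : (c *: f) s = c *: f s. Proof. exact: ffunE. Qed.
Lemma SnFun_star f s : (star f) s = star (f s). Proof. exact: ffunE. Qed.

Lemma SnFun_ev s : star_hom (fun f : SnFun n A => f s).
Proof.
split=> [f g|c f|f g||f];
  by rewrite (SnFunD, SnFunZ, SnFunM, SnFun1, SnFun_star).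
Qed.

Definition SnFun_cst (x : A) : SnFun n A := [ffun=> x].
Definition SnFun_delta s : SnFun n A := [ffun t => (t == s)%:R].

Lemma SnFun_cstE x s : SnFun_cst x s = x. Proof. exact: ffunE. Qed.
Lemma SnFun_deltaE s t : SnFun_delta s t = (t == s)%:R. Proof. exact: ffunE. Qed.

Lemma SnFun_cst_hom : star_hom SnFun_cst.
Proof.
split=> [x y|c x|x y||x]; apply/ffunP => s; rewrite [LHS]SnFun_cstE.
- by rewrite SnFunD !SnFun_cstE.
- by rewrite SnFunZ SnFun_cstE.
- by rewrite SnFunM !SnFun_cstE.
- by rewrite [RHS]SnFun1.
- by rewrite SnFun_star SnFun_cstE.
Qed.

Lemma SnFun_deltaM s t :
  SnFun_delta s * SnFun_delta t = SnFun_delta s *+ (s == t).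
Proof.
apply/ffunP => r; rewrite SnFunM !SnFun_deltaE.
have [->|st] := eqVneq s t.
  by rewrite mulr1n ffunE; case: (r == t); rewrite ?mulr1 ?mulr0.
rewrite mulr0n ffunE; have [->|] := eqVneq r s; last by rewrite mul0r.
by rewrite (negPf st) mulr0.
Qed.

Lemma SnFun_cst_deltaC x s :
  SnFun_cst x * SnFun_delta s = SnFun_delta s * SnFun_cst x.
Proof.
apply/ffunP => t; rewrite !SnFunM SnFun_cstE SnFun_deltaE.
by case: (t == s); rewrite (mulr1, mulr0) (mul1r, mul0r).
Qed.

Lemma SnFun_delta_decomp f : f = \sum_s SnFun_cst (f s) * SnFun_delta s.
Proof.
apply/ffunP => t; rewrite sum_ffunE (bigD1 t)//= big1 => [|s st].
  by rewrite addr0 SnFunM SnFun_cstE SnFun_deltaE eqxx mulr1.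
by rewrite SnFunM SnFun_cstE SnFun_deltaE eq_sym (negPf st) mulr0.
Qed.

Lemma sum_SnFun_delta : \sum_s SnFun_delta s = 1.
Proof.
rewrite [RHS]SnFun_delta_decomp; apply: eq_bigr => s _.
by rewrite SnFun1; have [_ _ _ -> _] := SnFun_cst_hom; rewrite mul1r.
Qed.

Lemma star_SnFun_delta s : star (SnFun_delta s) = SnFun_delta s.
Proof.
apply/ffunP => t; rewrite SnFun_star SnFun_deltaE.
by case: (t == s); rewrite (star1, star0).
Qed.

End SnFunTheory.

(** * The universal property of C*(G) (x) C(S_n) *)

Section MaximalUniversal.
Variables (R : realType) (G : groupType) (n : nat).
Local Notation M := (SnFun n (group_cstar R G)).

Definition bowtie_rep (g : G) : M := SnFun_cst n (group_unitary R g).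
Definition bowtie_idem (s : 'S_n) : M := SnFun_delta (group_cstar R G) s.

Lemma unitary_rep_comp (A B : cstarAlgType R) (pi : G -> A) (f : A -> B) :
  star_hom f -> unitary_rep pi -> unitary_rep (f \o pi).
Proof.
move=> [fD fZ fM f1 fS] [pi1 piM piS].
by split=> [|g h|g] /=; rewrite ?pi1 ?f1 ?piM ?fM// -fS piS.
Qed.

Lemma bowtie_rep_system : rep_system bowtie_rep bowtie_idem.
Proof.
split.
- exact: unitary_rep_comp (SnFun_cst_hom n _) (group_unitary_rep R G).
- exact: SnFun_deltaM.
- exact: sum_SnFun_delta.
- exact: star_SnFun_delta.
- by move=> g s; exact: SnFun_cst_deltaC.
Qed.

(** A function on S_n is the sum of its values times point masses, so the extension [F] of [pi] to
    C*(G) dictates h m = sum_s F (m s) Q s. Multiplicativity rests on [Q s] commuting with the whole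
    range of [F]. *)
Lemma bowtie_hom_exists (B : cstarAlgType R) (pi : G -> B) (Q : 'S_n -> B) :
  rep_system pi Q ->
  exists h : M -> B, [/\ star_hom h, forall g, h (bowtie_rep g) = pi g &
    forall s, h (bowtie_idem s) = Q s].
Proof.
move=> [piP QQ Q1 QS piQ].
have [F [[FH Fg] Funiq]] := group_cstar_universal piP.
have [FD FZ FM F1 FS] := FH.
have FQ x s : F x * Q s = Q s * F x.
  (* Conjugation by the symmetry 1 - 2 Q s fixes F by uniqueness. *)
  have [v vE] : exists v, v = 1 - (Q s + Q s) by eexists.
  have QQs : Q s * Q s = Q s by rewrite QQ eqxx.
  have vv : v * v = 1.
    rewrite vE mulrBl mul1r mulrBr mulr1 mulrDl !mulrDr QQs.
    by rewrite opprB addrK subrK.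
  have vS : star v = v by rewrite vE starB starD star1 QS.
  have : F = fun x => v * F x * v.
    apply: Funiq; split=> [|g].
      split=> [y z|c y|y z||y].
      - by rewrite FD mulrDr mulrDl.
      - by rewrite FZ -scalerAr -scalerAl.
      - by rewrite FM !mulrA -[_ * v * v]mulrA vv mulr1.
      - by rewrite F1 mulr1 vv.
      - by rewrite FS !starM vS !mulrA.
    rewrite Fg; have -> : v * pi g = pi g * v.
      by rewrite vE mulrBl mulrBr mul1r mulr1 mulrDl mulrDr piQ.
    by rewrite -mulrA vv mulr1.
  (* Hence [v] commutes with [F x], and so does [Q s], because [v] is 1 - 2 [Q s]. *)
  move/(congr1 (fun f => v * f x)); rewrite !mulrA vv mul1r.
  rewrite vE mulrBl mulrBr mul1r mulr1 => /addrI/oppr_inj.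
  rewrite mulrDl mulrDr -!mulr2n -[LHS]scaler_nat -[RHS]scaler_nat.
  by move/scalerI => -> //; rewrite pnatr_eq0.
exists (fun m => \sum_s F (m s) * Q s); split.
- split=> [x y|c x|x y||x].
  + by rewrite -big_split; apply: eq_bigr => s _; rewrite SnFunD FD mulrDl.
  + by rewrite scaler_sumr; apply: eq_bigr => s _; rewrite SnFunZ FZ scalerAl.
  + by rewrite blockM//; apply: eq_bigr => s _; rewrite SnFunM FM.
  + by rewrite -Q1; apply: eq_bigr => s _; rewrite SnFun1 F1 mul1r.
  + rewrite star_sum; apply: eq_bigr => s _.
    by rewrite SnFun_star FS starM QS -FS FQ.
- move=> g; rewrite -[RHS]mulr1 -Q1 mulr_sumr; apply: eq_bigr => s _.
  by rewrite /bowtie_rep SnFun_cstE Fg.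
- move=> s; rewrite (bigD1 s)//= SnFun_deltaE eqxx F1 mul1r big1 ?addr0// => t ts.
  by rewrite SnFun_deltaE (negPf ts) (star_hom0 FH) mul0r.
Qed.

(** On constants the universal property of C*(G) decides; constants times point masses span the
    algebra. *)
Lemma bowtie_hom_unique (B : cstarAlgType R) (h k : M -> B) :
  star_hom h -> star_hom k ->
  (forall g, h (bowtie_rep g) = k (bowtie_rep g)) ->
  (forall s, h (bowtie_idem s) = k (bowtie_idem s)) -> h = k.
Proof.
move=> hH kH hkg hks.
have cH := SnFun_cst_hom n (group_cstar R G).
have rP : unitary_rep (fun g => h (bowtie_rep g)).
  by apply: unitary_rep_comp => //; case: bowtie_rep_system.
have [F [_ Funiq]] := group_cstar_universal rP.
have hkc x : h (SnFun_cst n x) = k (SnFun_cst n x).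
  have Fh : F = h \o @SnFun_cst R n _.
    by apply: Funiq; split=> //; exact: star_hom_comp.
  have Fk : F = k \o @SnFun_cst R n _.
    by apply: Funiq; split=> //; exact: star_hom_comp.
  by rewrite -[LHS]/((h \o @SnFun_cst R n _) x) -Fh Fk.
apply/funext => m; rewrite (SnFun_delta_decomp m) !star_hom_sum//.
apply: eq_bigr => s _; have [_ _ hM _ _] := hH; have [_ _ kM _ _] := kH.
by rewrite hM kM hkc hks.
Qed.

End MaximalUniversal.

(** * Maximal versions *)

Section MaximalVersions.
Variables (R : realType) (n : nat).
Implicit Types (A B M : cstarAlgType R).

(** Since [iota] maps [Pol u] onto [Pol w], a homomorphism on [Pol w] pulls back to [Pol u], and the
    extension of the pullback to [M] also extends the original one. *)
Lemma maximal_version_idem A (u : 'M[A]_n) M (w : 'M[M]_n) :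
  maximal_version u w -> maximal_version w w.
Proof.
move=> [iota [iotaH iotau univ]]; have [iD iZ iM i1 iS] := iotaH.
have uA := Pol_star_subalgebra u; have [uP1 uPD uPZ uPM uPS] := uA.
have [wP1 wPD wPZ wPM wPS] := Pol_star_subalgebra w.
have iotaP x : Pol u x -> Pol w (iota x).
  (* [Pol u] is carried along because [iota] respects the operations only there. *)
  move=> ux; suff [] : Pol u x /\ Pol w (iota x) by [].
  apply: (ux (fun z => Pol u z /\ Pol w (iota z))); last first.
    by move=> i j; rewrite iotau; split; exact: Pol_gen.
  split=> [|y z [uy wy] [uz wz]|c y [uy wy]|y z [uy wy] [uz wz]|y [uy wy]].
  - by rewrite i1.
  - by rewrite iD//; split; [exact: uPD|exact: wPD].
  - by rewrite iZ//; split; [exact: uPZ|exact: wPZ].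
  - by rewrite iM//; split; [exact: uPM|exact: wPM].
  - by rewrite iS//; split; [exact: uPS|exact: wPS].
have iotaS y : Pol w y -> exists2 x, Pol u x & y = iota x.
  move=> wy; apply: (wy (fun z => exists2 x, Pol u x & z = iota x)); last first.
    by move=> i j; exists (u i j); [exact: Pol_gen|rewrite iotau].
  split=> [|y1 y2 [x1 p1 ->] [x2 p2 ->]|c y1 [x1 p1 ->]|
           y1 y2 [x1 p1 ->] [x2 p2 ->]|y1 [x1 p1 ->]].
  - by exists 1.
  - by exists (x1 + x2); [exact: uPD|rewrite iD].
  - by exists (c *: x1); [exact: uPZ|rewrite iZ].
  - by exists (x1 * x2); [exact: uPM|rewrite iM].
  - by exists (star x1); [exact: uPS|rewrite iS].
exists id; split=> // B f fH.
have [fD fZ fM f1 fS] := fH.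
have fiH : star_hom_on (Pol u) (f \o iota).
  split=> [x y ux uy|c x ux|x y ux uy||x ux] /=.
  - by rewrite iD// fD//; exact: iotaP.
  - by rewrite iZ// fZ//; exact: iotaP.
  - by rewrite iM// fM//; exact: iotaP.
  - by rewrite i1.
  - by rewrite iS// fS//; exact: iotaP.
have [g [[gH gi] guniq]] := univ B _ fiH; exists g; split.
  by split=> // y /iotaS[x ux ->]; exact: gi.
move=> g' [g'H g'i]; apply: guniq; split=> // x ux /=.
by rewrite g'i//; exact: iotaP.
Qed.

Lemma maximal_version_unique A (u : 'M[A]_n) M (w : 'M[M]_n) M' (w' : 'M[M']_n) :
  maximal_version u w -> maximal_version u w' -> CMQG_iso w w'.
Proof.
move=> [i [iH iu univ]] [i' [i'H i'u univ']].
have [g [[gH gi] _]] := univ _ _ i'H; have [h [[hH hi] _]] := univ' _ _ iH.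
(* Uniqueness for [i] and [i'] themselves identifies [h \o g] and [g \o h] with the identities. *)
have [k [_ kuniq]] := univ _ _ iH; have [k' [_ k'uniq]] := univ' _ _ i'H.
have hg : h \o g = id.
  rewrite -(kuniq id); last by split=> //; exact: star_hom_id.
  symmetry; apply: kuniq; split=> [|x ux /=]; first exact: star_hom_comp.
  by rewrite gi// hi.
have gh : g \o h = id.
  rewrite -(k'uniq id); last by split=> //; exact: star_hom_id.
  symmetry; apply: k'uniq; split=> [|x ux /=]; first exact: star_hom_comp.
  by rewrite hi// gi.
exists g; split=> // [|a b]; last by rewrite -iu gi ?i'u//; exact: Pol_gen.
by exists h => x; [exact: (congr1 (@^~ x) hg)|exact: (congr1 (@^~ x) gh)].
Qed.

Lemma CMQG_iso_refl A (u : 'M[A]_n) : CMQG_iso u u.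
Proof. by exists id; split=> //; exists id. Qed.

Lemma CMQG_iso_trans A (u : 'M[A]_n) B (v : 'M[B]_n) M (w : 'M[M]_n) :
  CMQG_iso u v -> CMQG_iso v w -> CMQG_iso u w.
Proof.
move=> [f [fH fb fu]] [g [gH gb gv]]; exists (g \o f); split=> [||i j /=].
- exact: star_hom_comp.
- exact: bij_comp.
- by rewrite fu gv.
Qed.

End MaximalVersions.

(** * The group generated by symmetries of a C*-algebra *)

Section WordGroup.
Variables (R : realType) (A : cstarAlgType R) (n : nat).

Record symmetries := Symmetries {
  symmetry :> 'I_n -> A;
  symmetry_sqr : forall i, symmetry i * symmetry i = 1;
  symmetry_star : forall i, star (symmetry i) = symmetry i
}.

Definition word (a : 'I_n -> A) (w : seq 'I_n) : A := \prod_(i <- w) a i.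

Variable a : symmetries.

Lemma word_star w : star (word a w) = word a (rev w).
Proof.
elim: w => [|i w IH]; first by rewrite /word !big_nil star1.
rewrite /word rev_cons -cats1 big_cat big_seq1 big_cons starM symmetry_star.
by rewrite -/(word a w) IH.
Qed.

Lemma star_word_mul w : star (word a w) * word a w = 1.
Proof.
elim: w => [|i w IH]; first by rewrite /word !big_nil star1 mulr1.
rewrite /word big_cons starM symmetry_star -/(word a w) -mulrA.
by rewrite [a i * _]mulrA symmetry_sqr mul1r.
Qed.

Lemma word_mul_star w : word a w * star (word a w) = 1.
Proof. by rewrite word_star -{1}(revK w) -word_star star_word_mul. Qed.

Lemma word_push i w : word a (push i w) = a i * word a w.
Proof.
case: w => [|j w] /=; first by rewrite /word big_seq1 big_nil mulr1.
case: eqVneq => [<-|_]; last by rewrite /word !big_cons.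
by rewrite /word big_cons mulrA symmetry_sqr mul1r.
Qed.

Lemma word_foldr_push v w : word a (foldr (@push n) w v) = word a v * word a w.
Proof.
elim: v => [|i v IH] /=; first by rewrite /word big_nil mul1r.
by rewrite word_push IH /word big_cons mulrA.
Qed.

(** Elements are values of words in [A], so words are identified exactly when they agree in [A];
    [star] is the inverse. *)
Definition word_group := {x : A | `[< exists w, x = word a w >]}.
HB.instance Definition _ := Choice.on word_group.

Lemma word_groupP (g : word_group) : exists w, val g = word a w.
Proof. by apply/asboolP; exact: (valP g). Qed.

Definition of_word w : word_group :=
  exist _ (word a w) (asboolT (ex_intro _ w erefl)).

Let is_word_mul (g h : word_group) : `[< exists w, val g * val h = word a w >].
Proof.
apply/asboolP; have [[v ->] [w ->]] := (word_groupP g, word_groupP h).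
by exists (v ++ w); rewrite /word big_cat.
Qed.
Let is_word_inv (g : word_group) : `[< exists w, star (val g) = word a w >].
Proof.
by apply/asboolP; have [w ->] := word_groupP g; exists (rev w); rewrite word_star.
Qed.
Let wone := of_word [::].
Let wmul (g h : word_group) : word_group := exist _ (val g * val h) (is_word_mul g h).
Let winv (g : word_group) : word_group := exist _ (star (val g)) (is_word_inv g).

Let wmulA : associative wmul.
Proof. by move=> x y z; apply: val_inj; exact: mulrA. Qed.
Let wmul1 : left_id wone wmul.
Proof. by move=> x; apply: val_inj; rewrite /= /word big_nil mul1r. Qed.
Let wmulr1 : right_id wone wmul.
Proof. by move=> x; apply: val_inj; rewrite /= /word big_nil mulr1. Qed.
Let wmulV : left_inverse wone winv wmul.
Proof.
move=> x; apply: val_inj; have [w /= ->] := word_groupP x.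
by rewrite star_word_mul /word big_nil.
Qed.
Let wmulrV : right_inverse wone winv wmul.
Proof.
move=> x; apply: val_inj; have [w /= ->] := word_groupP x.
by rewrite word_mul_star /word big_nil.
Qed.
HB.instance Definition _ :=
  isGroup.Build word_group wmulA wmul1 wmulr1 wmulV wmulrV.

Lemma word_group_rep : unitary_rep (fun g : word_group => val g).
Proof. by split=> //; rewrite /= /word big_nil. Qed.

Lemma word_group_neq0 (g : word_group) : val g <> 0.
Proof.
have [w ->] := word_groupP g => w0; have := star_word_mul w.
by rewrite w0 mulr0 => /esym/eqP; rewrite oner_eq0.
Qed.

Lemma of_word_Z2mul (v w : Z2free n) :
  of_word (val (v * w)%g) = (of_word (val v) * of_word (val w))%g.
Proof. by apply: val_inj; exact: word_foldr_push. Qed.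

Lemma of_word_surj (g : word_group) : exists w : Z2free n, of_word (val w) = g.
Proof.
have [w gw] := word_groupP g.
(* Pushing the letters of [w] onto the empty word reduces it without changing its value in [A]. *)
have w_red : reduced (foldr (@push n) [::] w) by exact: foldr_push_reduced.
exists (exist _ (foldr (@push n) [::] w) w_red); apply: val_inj.
rewrite /= gw word_foldr_push.
by rewrite [word a [::]]/word big_nil mulr1.
Qed.

End WordGroup.

(** * Homogeneous quantum groups with central squares *)

(** Serves to collect equal group elements in a combination, as independence concerns distinct
    ones. *)
Lemma factor_through_injection (J : finType) (T : eqType) (g : J -> T) :
  exists m (b : 'I_m -> T) (p : J -> 'I_m), injective b /\ forall j, g j = b (p j).
Proof.
pose s := undup (codom g).
have gs j : (index (g j) s < size s)%N by rewrite index_mem mem_undup codom_f.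
exists (size s), (tnth (in_tuple s)), (fun j => Ordinal (gs j)).
split=> [|j]; first exact/tuple_uniqP/undup_uniq.
by rewrite (tnth_nth (g j)) /= nth_index// mem_undup codom_f.
Qed.

(** By the C*-identity it is enough that (x^3 - x)^2 = x^6 - 2 x^4 + x^2 vanishes, and x^6 = x^4 =
    x^2. *)
Lemma selfadjoint_cube (R : realType) (A : cstarAlgType R) (x : A) :
  star x = x -> x * x * (x * x) = x * x -> x * (x * x) = x.
Proof.
move=> xS; rewrite mulrA => x4; apply/eqP; rewrite -subr_eq0.
apply/eqP/cnorm_eq0/eqP; rewrite -sqrf_eq0 -cnorm_star2 starB !starM xS.
by rewrite mulrBl !mulrBr !mulrA !x4 !subrr cnorm0.
Qed.

Section HomogeneousSymmetric.
Variables (R : realType) (n : nat) (A : cstarAlgType R) (u : 'M[A]_n).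
Hypothesis u_row : forall i, \sum_k u i k * star (u i k) = 1.
Hypothesis u_col : forall j, \sum_k star (u k j) * u k j = 1.
Hypothesis u_sa : forall i j, star (u i j) = u i j.
Hypothesis u_central : forall i j, central_projection (u i j ^+ 2).
Variable f : A -> SnFun n R[i]^o.
Hypothesis fH : star_hom f.
Hypothesis fu : forall i j, f (u i j) = perm_fun R i j.
Variables (T : cstarAlgType R) (i1 i2 : A -> T).
Hypothesis i12 : tensor_embedding i1 i2.
Variable Delta : A -> T.
Hypothesis uDelta : comultiplication u i1 i2 Delta.

Let p i j := u i j * u i j.
Local Notation P := (perm_idempotent p).

Lemma sqr_entry_central i j : central_idempotent (p i j).
Proof. by have [pp _ pC] := u_central i j; split; [exact: pp|exact: pC]. Qed.
Let pP := sqr_entry_central.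

Let p_row i : \sum_j p i j = 1.
Proof. by rewrite -(u_row i); apply: eq_bigr => j _; rewrite u_sa. Qed.

Let p_col j : \sum_i p i j = 1.
Proof. by rewrite -(u_col j); apply: eq_bigr => i _; rewrite u_sa. Qed.

Let p_star i j : star (p i j) = p i j.
Proof. by rewrite starM u_sa. Qed.

Lemma entry_mul_sqr i j : u i j * p i j = u i j.
Proof. by apply: selfadjoint_cube (u_sa i j) _; have [] := pP i j. Qed.

Let row_sym i := \sum_j u i j.

Let row_symE i j : row_sym i * p i j = u i j.
Proof.
rewrite mulr_suml (bigD1 j)//= entry_mul_sqr big1 ?addr0// => k kj.
rewrite -entry_mul_sqr -mulrA.
by rewrite (partition_of_unity_orthogonal (q := p i))// mulr0.
Qed.

Let row_sym_sqr i : row_sym i * row_sym i = 1.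
Proof.
rewrite {2}/row_sym mulr_sumr -[RHS](p_row i); apply: eq_bigr => j _.
have [pp pC] := pP i j.
(* A factor [p i j] split off from [u i j] turns [row_sym i] into [u i j]. *)
by rewrite -{1}entry_mul_sqr -pC mulrA row_symE.
Qed.

Let row_sym_star i : star (row_sym i) = row_sym i.
Proof. by rewrite star_sum; apply: eq_bigr => j _; exact: u_sa. Qed.

Definition row_symmetries : symmetries A n := Symmetries row_sym_sqr row_sym_star.
Local Notation a := row_symmetries.
Local Notation G := (word_group a).

Let PC := perm_idempotentC pP.
Let PP := perm_idempotentM pP p_col.
Let sumP := sum_perm_idempotent pP p_row p_col.

Let uE i j : u i j = \sum_s (a i * P s) *+ (s j == i).
Proof.
rewrite -[LHS]row_symE [in LHS](entry_sum_perm_idempotent pP p_row p_col) mulr_sumr.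
by apply: eq_bigr => s _; rewrite mulrnAr.
Qed.

Lemma word_rep_system : rep_system (fun g : G => val g) P.
Proof.
split=> // [|s]; first exact: word_group_rep.
rewrite /P; elim: (index_enum _) => [|j r IH]; first by rewrite big_nil star1.
by rewrite big_cons starM IH p_star; have [_ ->] := pP (s j) j.
Qed.

(** * The characters of [A] given by the points of S_n *)

Let phi (t : 'S_n) (x : A) : R[i]^o := f x t.

Let phiH t : star_hom (phi t).
Proof. exact: star_hom_comp fH (SnFun_ev _ t). Qed.

Let phi_u t i j : phi t (u i j) = (t j == i)%:R.
Proof. by rewrite /phi fu ffunE. Qed.

Let phi_p t i j : phi t (p i j) = (t j == i)%:R.
Proof.
by have [_ _ fM _ _] := phiH t; rewrite fM phi_u; case: eqP; rewrite (mulr0, mulr1).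
Qed.

Let phi_P t s : phi t (P s) = (t == s)%:R.
Proof.
have [fD fZ fM f1 fS] := phiH t.
have neq r : t != r -> phi t (P r) = 0.
  move=> tr; have [j trj] : exists j, t j != r j.
    by apply/existsP; rewrite -negb_forall; apply: contra tr => /forallP h;
      apply/eqP/permP => j; apply/eqP.
  (* [P r] annihilates [p (t j) j], on which [phi t] is 1. *)
  have := congr1 (phi t) (perm_idempotent_mul_entry pP p_col r (t j) j).
  rewrite fM phi_p eqxx mulr1 => ->.
  by rewrite eq_sym (negPf trj) mulr0n (star_hom0 (phiH t)).
have [<-|/neq//] := eqVneq t s.
have := congr1 (phi t) sumP; rewrite (star_hom_sum (phiH t)) f1 (bigD1 t)//=.
by rewrite big1 ?addr0// => r rt; rewrite neq// eq_sym.
Qed.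

Let phi_a t i : phi t (a i) = 1.
Proof.
rewrite (star_hom_sum (phiH t)) (bigD1 ((t^-1)%g i))//= phi_u permKV eqxx.
rewrite big1 ?addr0// => j ji; rewrite phi_u.
by case: (eqVneq (t j) i) => // tj; rewrite -tj permK eqxx in ji.
Qed.

Let phi_word t w : phi t (word a w) = 1.
Proof.
by rewrite (star_hom_prod (phiH t)) big1 // => i _; rewrite phi_a.
Qed.

(** * The block form of the comultiplication *)

Let DH : star_hom Delta := uDelta.1.
Let i1H : star_hom i1. Proof. by case: i12. Qed.
Let i2H : star_hom i2. Proof. by case: i12. Qed.
Let i12C x y : i1 x * i2 y = i2 y * i1 x. Proof. by case: i12. Qed.

(** In the block cut out by P_s (x) 1, [Delta x] is the single elementary tensor x' (x) y_s. The
    generators have this form and products preserve it. *)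
Let D_block x x' (y : 'S_n -> A) :=
  Delta x = \sum_s (i1 x' * i2 (y s)) * i1 (P s).

Let i1_PP s t : i1 (P s) * i1 (P t) = i1 (P s) *+ (s == t).
Proof.
have [_ _ i1M _ _] := i1H; rewrite -i1M PP.
by case: (s == t); rewrite ?mulr1n// !mulr0n (star_hom0 i1H).
Qed.

Let i1_PC s x y : i1 (P s) * (i1 x * i2 y) = i1 x * i2 y * i1 (P s).
Proof.
have [_ _ i1M _ _] := i1H.
by rewrite mulrA -i1M PC i1M -!mulrA i12C.
Qed.

Let D_blockM x x' y z z' v : D_block x x' y -> D_block z z' v ->
  D_block (x * z) (x' * z') (fun s => y s * v s).
Proof.
have [_ _ DM _ _] := DH; have [_ _ i1M _ _] := i1H; have [_ _ i2M _ _] := i2H.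
move=> xy zv; rewrite /D_block DM xy zv blockM//.
apply: eq_bigr => s _; congr (_ * _).
by rewrite i1M i2M -!mulrA; congr (_ * _); rewrite !mulrA i12C.
Qed.

Let sum_i1P : \sum_s i1 (P s) = 1.
Proof.
by rewrite -(star_hom_sum i1H) sumP; case: i1H.
Qed.

Let D_block1 : D_block 1 1 (fun=> 1).
Proof.
have [_ _ _ D1 _] := DH; have [_ _ _ i11 _] := i1H; have [_ _ _ i21 _] := i2H.
rewrite /D_block D1 -sum_i1P; apply: eq_bigr => s _.
by rewrite i11 i21 !mul1r.
Qed.

(** As u_ik is the sum of the a_i P_s with s k = i, only k = s^-1 i contributes to block s of sum_k
    u_ik (x) u_kj. *)
Let D_block_u i j : D_block (u i j) (a i) (fun s => u ((s^-1)%g i) j).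
Proof.
have [_ Du] := uDelta; have [_ _ i1M _ _] := i1H.
rewrite /D_block Du.
transitivity (\sum_k \sum_s (i1 (a i) * i2 (u k j)) * i1 (P s) *+ (s k == i)).
  apply: eq_bigr => k _; rewrite {1}(uE i k) (star_hom_sum i1H) mulr_suml.
  apply: eq_bigr => s _; case: (s k == i).
    by rewrite !mulr1n i1M -!mulrA [i1 (P s) * _]i12C.
  by rewrite !mulr0n (star_hom0 i1H) mul0r.
rewrite exchange_big; apply: eq_bigr => s _ /=.
rewrite (bigD1 ((s^-1)%g i))//= permKV eqxx mulr1n big1 ?addr0// => k ki.
by case: (eqVneq (s k) i) => // sk; rewrite -sk permK eqxx in ki.
Qed.

Let D_block_a i : D_block (a i) (a i) (fun s => a ((s^-1)%g i)).
Proof.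
rewrite /D_block {1}/a /= /row_sym (star_hom_sum DH).
rewrite (eq_bigr _ (fun j _ => D_block_u i j)).
rewrite exchange_big; apply: eq_bigr => s _ /=.
by rewrite -mulr_suml -mulr_sumr (star_hom_sum i2H).
Qed.

Let D_block_p i j : D_block (p i j) 1 (fun s => p ((s^-1)%g i) j).
Proof. by have := D_blockM (D_block_u i j) (D_block_u i j); rewrite symmetry_sqr. Qed.

(** Block [r] turns the row index [s j] into r^-1 (s j); permutations compose from left to right,
    hence [s * r^-1]. *)
Let D_block_P s : D_block (P s) 1 (fun r => P (s * r^-1)%g).
Proof.
rewrite /perm_idempotent; elim: (index_enum _) => [|j r IH].
  rewrite big_nil; have := D_block1; rewrite /D_block => ->.
  by apply: eq_bigr => r _; rewrite big_nil.
rewrite big_cons; have := D_blockM (D_block_p (s j) j) IH.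
rewrite mul1r /D_block => ->; apply: eq_bigr => t _.
by rewrite big_cons permM.
Qed.

Let D_block_word w :
  D_block (word a w) (word a w) (fun s => word a (map (s^-1)%g w)).
Proof.
elim: w => [|i w IH].
  by rewrite /word big_nil; exact: D_block1.
by have := D_blockM (D_block_a i) IH; rewrite /word /= !big_cons /D_block => ->;
  apply: eq_bigr => s _; rewrite big_cons.
Qed.

Let D_block_at s x x' y : D_block x x' y ->
  Delta x * i1 (P s) = i1 (x' * P s) * i2 (y s).
Proof.
have [_ _ i1M _ _] := i1H.
move=> ->; rewrite mulr_suml (bigD1 s)//= big1 ?addr0 => [|t ts].
  by rewrite -mulrA i1_PP eqxx mulr1n i1M -!mulrA i12C.
by rewrite -mulrA i1_PP (negPf ts) mulr0n mulr0.
Qed.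

(** * Linear independence of the products of words and permutation idempotents *)

Lemma word_perm_idempotent_eq0 (J : finType) (c : J -> R[i]) (g : J -> G) s :
  (\sum_j c j *: val (g j)) * P s = 0 -> \sum_j c j *: val (g j) = 0.
Proof.
move=> x0; set x := \sum_j _.
suff xP t : x * P t = 0 by rewrite -[x]mulr1 -sumP mulr_sumr big1.
have /choice[w gw] j := word_groupP (g j).
have [_ DZ DM _ _] := DH; have [_ i1Z i1M _ _] := i1H.
have [_ _ phiM _ _] := phiH (s * t^-1)%g.
(* Block [t] of [Delta] at x P_s = 0. The character at [s * t^-1] is 1 on every second leg, so
   slicing with it leaves x P_t = 0. *)
have : \sum_j i1 (c j *: (val (g j) * P t)) *
         i2 (word a (map (t^-1)%g (w j)) * P (s * t^-1)%g) = 0.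
  transitivity (Delta 0 * i1 (P t)); last by rewrite (star_hom0 DH) mul0r.
  rewrite -[in RHS]x0 mulr_suml.
  rewrite (star_hom_sum DH) mulr_suml; apply: eq_bigr => j _.
  rewrite -scalerAl DZ -scalerAl gw.
  have := D_blockM (D_block_word (w j)) (D_block_P s); rewrite mulr1.
  by move/D_block_at => ->; rewrite i1Z scalerAl.
move/(tensor_slice i12 (phiH (s * t^-1)%g)) => h; rewrite -[RHS]h mulr_suml.
apply: eq_bigr => j _.
by rewrite phiM phi_word phi_P eqxx mulr1 scale1r -scalerAl.
Qed.

Lemma word_group_lin_indep m (b : 'I_m -> G) :
  injective b -> lin_indep (fun k => val (b k)).
Proof.
elim: m b => [|m IH] b b_inj c cb0; first by case.
have [_ _ _ tens] := i12; have [_ DZ _ _ _] := DH.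
have [i1D i1Z i1M _ _] := i1H; have [_ i2Z _ _ _] := i2H.
pose b' k := b (lift ord0 k).
have b'_inj : injective b' by move=> k l /b_inj/lift_inj.
(* In the block of the identity permutation, group elements are group-like. *)
have Db k : Delta (val (b k)) * i1 (P 1%g) = i1 (val (b k) * P 1%g) * i2 (val (b k)).
  have [w ->] := word_groupP (b k).
  have := D_block_at 1%g (D_block_word w); rewrite invg1 => ->.
  by congr (_ * i2 (word a _)); rewrite -[RHS]map_id; apply: eq_map => j; rewrite perm1.
have c0 k : c (lift ord0 k) = 0.
  (* Dedekind's trick: the relation under [Delta], minus [b ord0] (x) the relation, loses its term
     of index 0. The remaining second legs are independent by induction, so each first leg
     vanishes. *)
  have : \sum_j i1 ((c (lift ord0 j) *: (val (b' j) - val (b ord0))) * P 1%g) *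
      i2 (val (b' j)) = 0.
    transitivity (\sum_j i1 ((c j *: (val (b j) - val (b ord0))) * P 1%g) *
        i2 (val (b j))).
      by rewrite big_ord_recl subrr scaler0 mul0r (star_hom0 i1H) mul0r add0r.
    transitivity (Delta (\sum_j c j *: val (b j)) * i1 (P 1%g) -
        i1 (val (b ord0) * P 1%g) * i2 (\sum_j c j *: val (b j))); last first.
      by rewrite cb0 (star_hom0 DH) (star_hom0 i2H) mul0r mulr0 subrr.
    rewrite (star_hom_sum DH) (star_hom_sum i2H) mulr_suml mulr_sumr -sumrB.
    apply: eq_bigr => j _; rewrite DZ i2Z -[in RHS]scalerAl -scalerAr Db -scalerBr.
    rewrite -[in RHS]mulrBl -[in LHS]scalerAl i1Z -scalerAl; congr (_ *: (_ * _)).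
    by rewrite mulrBl i1D -scaleN1r i1Z scaleN1r.
  move/(tens _ _ _ (IH _ b'_inj))/(_ k).
  (* The first leg is a two-term combination times [P 1]; indexing it by [bool] lets the previous
     lemma strip [P 1]. *)
  pose g (j : bool) := if j then b' k else b ord0.
  pose d (j : bool) := if j then c (lift ord0 k) else - c (lift ord0 k).
  have dg : c (lift ord0 k) *: (val (b' k) - val (b ord0)) = \sum_j d j *: val (g j).
    by rewrite big_bool scalerBr scaleNr.
  rewrite dg => /word_perm_idempotent_eq0; rewrite -dg => /eqP.
  rewrite scaler_eq0 subr_eq0 => /orP[/eqP//|/eqP/val_inj/b_inj/eqP].
  by rewrite lift_eqF.
have : c ord0 *: val (b ord0) = 0.
  rewrite -[RHS]cb0 big_ord_recl big1 ?addr0// => k _.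
  by rewrite c0 scale0r.
move/eqP; rewrite scaler_eq0 => /orP[/eqP h k|/eqP/word_group_neq0//].
by case: (unliftP ord0 k) => [l|] ->.
Qed.

(** Once equal group elements are collected, independence makes all coefficients vanish, so the
    relation passes to any [rho]. *)
Lemma word_group_free (J : finType) (c : J -> R[i]) (g : J -> G)
    (V : lmodType R[i]) (rho : G -> V) :
  \sum_j c j *: val (g j) = 0 -> \sum_j c j *: rho (g j) = 0.
Proof.
have [m [b [q [b_inj gE]]]] := factor_through_injection g.
have E (W : lmodType R[i]) (sg : G -> W) :
    \sum_j c j *: sg (g j) = \sum_k (\sum_(j | q j == k) c j) *: sg (b k).
  rewrite (partition_big q xpredT)//=; apply: eq_bigr => k _.
  by rewrite scaler_suml; apply: eq_bigr => j /eqP <-; rewrite gE.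
rewrite (E _ (fun g => val g)) => /(word_group_lin_indep b_inj) d0.
by rewrite E big1// => k _; rewrite d0 scale0r.
Qed.

(** In block [t] only the terms with s j = t survive. There [P t] can be stripped, and the relation
    between group elements passes to [rho]. *)
Lemma combo_word_eq0 (B : cstarAlgType R) (rho : G -> B) (Q : 'S_n -> B)
    (J : finType) (c : J -> R[i]) (g : J -> G) (s : J -> 'S_n) :
  rep_system rho Q ->
  combo (fun g : G => val g) P c g s = 0 -> combo rho Q c g s = 0.
Proof.
move=> [_ QQ Q1 _ _] x0.
rewrite -[combo _ _ _ _ _]mulr1 -Q1 mulr_sumr big1// => t _.
have E (D : cstarAlgType R) (sg : G -> D) (S : 'S_n -> D) :
    (forall s t, S s * S t = S s *+ (s == t)) ->
    combo sg S c g s * S t = (\sum_j (c j *+ (s j == t)) *: sg (g j)) * S t.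
  move=> SS; rewrite !mulr_suml; apply: eq_bigr => j _.
  rewrite -!scalerAl -mulrA SS; case: eqP => [->|_]; first by rewrite !mulr1n.
  by rewrite !mulr0n mulr0 scaler0 scale0r.
have := E _ (fun g : G => val g) _ PP; rewrite x0 mul0r => /esym/word_perm_idempotent_eq0.
by move/(word_group_free rho); rewrite E// => ->; rewrite mul0r.
Qed.

(** If w = 1, block s^-1 of Delta(w) = 1 reads P_{s^-1} (x) (s(w) - 1) = 0, and a character shows
    that P_{s^-1} is nonzero. *)
Lemma word_perm_eq1 (s : 'S_n) w : word a w = 1 -> word a (map s w) = 1.
Proof.
move=> w1; have [_ _ _ D1 _] := DH; have [i1D i1Z i1M _ _] := i1H.
have [i2D i2Z i2M i21 _] := i2H.
have := D_block_at (s^-1)%g (D_block_word w); rewrite w1 invgK mul1r D1 mul1r => h.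
have {}h : i1 (P (s^-1)%g) * i2 (word a (map s w) - 1) = 0.
  by rewrite i2D -scaleN1r i2Z i21 scaleN1r mulrBr mulr1 -h subrr.
apply: contrapT => /eqP; rewrite -subr_eq0 => y0.
have [_ _ _ tens] := i12.
have yI : lin_indep (fun _ : 'I_1 => word a (map s w) - 1).
  move=> c; rewrite big_ord1 => /eqP; rewrite scaler_eq0 (negPf y0) orbF => /eqP c0 k.
  by rewrite (ord1 k).
have := tens 1%N (fun=> P (s^-1)%g) _ yI; rewrite big_ord1 => /(_ h ord0) P0.
have := phi_P (s^-1)%g (s^-1)%g; rewrite P0 (star_hom0 (phiH _)) eqxx.
by move/esym/eqP; rewrite oner_eq0.
Qed.

(** * The enveloping C*-algebra of Pol(A) *)

Lemma Pol_word w : Pol u (word a w).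
Proof.
have UA := Pol_star_subalgebra u.
apply: (star_subalgebra_prod UA) => i; apply: (star_subalgebra_sum UA) => j.
exact: Pol_gen.
Qed.

Lemma Pol_word_group (g : G) : Pol u (val g).
Proof. by have [w ->] := word_groupP g; exact: Pol_word. Qed.

Lemma Pol_perm_idempotent s : Pol u (P s).
Proof.
have UA := Pol_star_subalgebra u; have [_ _ _ UM _] := UA.
by apply: (star_subalgebra_prod UA) => j; apply: UM; exact: Pol_gen.
Qed.

Local Notation corr := (corresponds (fun g : G => val g) P
  (@bowtie_rep R G n) (@bowtie_idem R G n)).

Lemma corresponds_entry i j :
  corr (u i j) (bowtie R (fun i => of_word a [:: i]) i j).
Proof.
exists 'S_n, (fun s : 'S_n => (s j == i)%:R), (fun=> of_word a [:: i]), id; split.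
  rewrite uE; apply: eq_bigr => s _.
  by rewrite scaler_nat /= /word big_seq1.
rewrite mxE; apply/ffunP => s; rewrite ffunE sum_ffunE (bigD1 s)//=.
rewrite big1 ?addr0 => [|t ts]; rewrite SnFunZ SnFunM SnFun_cstE SnFun_deltaE.
  by rewrite eqxx mulr1 ffunE.
by rewrite (eq_sym s) (negPf ts) mulr0 scaler0.
Qed.

(** [iota] exists because Pol(A) satisfies no relations beyond those of C[G] (x) C(S_n). A
    homomorphism on Pol(A) restricts to a [rep_system], which the universal property of the target
    extends. *)
Lemma maximal_version_bowtie :
  maximal_version u (bowtie R (fun i => of_word a [:: i])).
Proof.
have piP := word_rep_system; have rhoT := bowtie_rep_system R G n.
have UA := Pol_star_subalgebra u; have [U1 UD UZ UM US] := UA.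
have z J c g s := @combo_word_eq0 _ _ _ J c g s rhoT.
have dom x : Pol u x -> exists y, corr x y.
  (* The domain of the relation is a *-subalgebra containing the entries of [u]. *)
  move=> ux; apply: (ux (fun x => exists y, corr x y)); last first.
    by move=> i j; eexists; exact: corresponds_entry.
  split=> [|x1 x2 [y1 h1] [y2 h2]|c x1 [y1 h1]|x1 x2 [y1 h1] [y2 h2]|x1 [y1 h1]]; eexists.
  - exact: corresponds1.
  - exact: correspondsD h1 h2.
  - exact: correspondsZ h1.
  - exact: correspondsM h1 h2.
  - exact: corresponds_star h1.
have [iota [iotaH iotaE]] := star_hom_on_corresponds piP rhoT z UA dom.
exists iota; split=> // [i j|B h hH]; first exact/iotaE/corresponds_entry.
have [hD hZ hM h1 hS] := hH.
have [[r1 rM rS] QQ Q1 QS rQ] := piP.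
have hP : rep_system (fun g : G => h (val g)) (fun s => h (P s)).
  split=> [|s t||s|g s].
  - split=> [|g g'|g]; first by rewrite -h1; exact: (congr1 h r1).
      by rewrite -hM; [exact: (congr1 h (rM g g'))|exact: Pol_word_group..].
    by rewrite -hS; [exact: (congr1 h (rS g))|exact: Pol_word_group].
  - rewrite -hM; [|exact: Pol_perm_idempotent..].
    rewrite PP; case: (s == t); rewrite ?mulr1n// !mulr0n.
    by rewrite -(scale0r 1) hZ// scale0r.
  - rewrite -(star_hom_on_sum UA hH); last exact: Pol_perm_idempotent.
    by rewrite Q1.
  - by rewrite -hS ?QS//; exact: Pol_perm_idempotent.
  - have [Ug UP] := (Pol_word_group g, Pol_perm_idempotent s).
    by rewrite -!hM//; exact: (congr1 h (rQ g s)).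
have [k [kH kg ks]] := bowtie_hom_exists hP.
exists k; split; last first.
  move=> k' [k'H k'i]; apply: (bowtie_hom_unique kH k'H) => [g|s].
    rewrite kg -(iotaE _ _ (corresponds_rep piP rhoT g)) k'i//.
    exact: Pol_word_group.
  rewrite ks -(iotaE _ _ (corresponds_idem piP rhoT s)) k'i//.
  exact: Pol_perm_idempotent.
(* On a combination both sides are determined by their values on words and on the [P s]. *)
split=> // x ux; have [y xy] := dom x ux; rewrite (iotaE _ _ xy).
have [J [c [g [s [-> ->]]]]] := xy.
have UPg j : Pol u (val (g j) * P (s j)).
  by apply: UM; [exact: Pol_word_group|exact: Pol_perm_idempotent].
rewrite (star_hom_sum kH) (star_hom_on_sum UA hH) => [|j]; last exact: UZ.
apply: eq_bigr => j _; have [_ kZ kM _ _] := kH; rewrite kZ kM hZ// hM ?kg ?ks//.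
  exact: Pol_word_group.
exact: Pol_perm_idempotent.
Qed.

End HomogeneousSymmetric.

Theorem theorem1 (R : realType) (n : nat) (A : cstarAlgType R) (u : 'M[A]_n)
    (u_CMQG : is_CMQG u) (u_homogeneous : homogeneous u)
    (u_selfadjoint : forall i j, star (u i j) = u i j)
    (u_sqr_central : forall i j, central_projection (u i j ^+ 2)) :
  exists (Gamma : groupType) (q : Z2free n -> Gamma),
    [/\ {morph q : v w / (v * w)%g >-> (v * w)%g},
        (forall g : Gamma, exists w, q w = g),
        (forall (s : 'S_n) (w : Z2free n), q w = 1%g -> q (Z2perm s w) = 1%g),
        version_of u (bowtie R (fun i => q (Z2gen i))) &
        (in_maximal_version u ->
           CMQG_iso u (bowtie R (fun i => q (Z2gen i))))].
Proof.
have [[u_row u_col] _ [T [i1 [i2 [[i12 _ _] [Delta uDelta]]]]] _] := u_CMQG.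
have [f [fH fu]] := u_homogeneous.
have row i : \sum_k u i k * star (u i k) = 1.
  have := congr1 (fun M : 'M[A]_n => M i i) u_row; rewrite !mxE eqxx => h.
  rewrite -[RHS]h.
  by apply: eq_bigr => k _; rewrite mxE.
have col j : \sum_k star (u k j) * u k j = 1.
  have := congr1 (fun M : 'M[A]_n => M j j) u_col; rewrite !mxE eqxx => h.
  rewrite -[RHS]h.
  by apply: eq_bigr => k _; rewrite mxE.
pose a := row_symmetries row u_selfadjoint u_sqr_central.
have uM : maximal_version u (bowtie R (fun i => of_word a [:: i])).
  exact: (maximal_version_bowtie row col u_selfadjoint u_sqr_central fH fu i12 uDelta).
exists (word_group a), (fun w => of_word a (val w)); split.
- exact: of_word_Z2mul.
- exact: of_word_surj.
- move=> s w /(congr1 val) w1; apply: val_inj.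
  have {}w1 : word a (val w) = 1 by rewrite [LHS]w1 /= /word big_nil.
  rewrite /= [RHS]/word big_nil.
  exact: (word_perm_eq1 col fH fu i12 uDelta s w1).
(* A maximal version of [u] is its own maximal version, so identities witness both clauses. *)
- split.
    by do 2 eexists; split; [exact: maximal_version_idem uM|exact: CMQG_iso_refl].
  by do 2 eexists; split; [exact: uM|exact: CMQG_iso_refl].
- move=> [M [w [uw u_w]]].
  (* [u] is isomorphic to one of its maximal versions, and any two of these are isomorphic. *)
  exact: CMQG_iso_trans u_w (maximal_version_unique uw uM).
Qed.
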